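(* Let $\mathcal T$ be a Grothendieck topology on $\mathbf{Aff}$, and let $\Phi:(X_0,X_1)\to(Y_0,Y_1)$ be an internal equivalence (with respect to $\mathcal T$) of presheaves of groupoids on $\mathbf{Aff}_{\mathcal T}$. Then the functor $\Phi^*:\mathbf{Sh}^{\mathcal T}_{(Y_0,Y_1)}\to\mathbf{Sh}^{\mathcal T}_{(X_0,X_1)}$ is an equivalence of categories.
   Context: All rings are commutative with unit and of cardinality less than a fixed infinite cardinal $\kappa$; $\mathbf{Rings}$ is the category of such rings and $\mathbf{Aff}$ its opposite (regarded as a small category). A Grothendieck topology $\mathcal T$ on $\mathbf{Aff}$ is given by covers, which are families of ring maps $\{R\to S_i\}$; $\mathbf{Aff}_{\mathcal T}$ is the resulting site. A presheaf of groupoids is a functor $(X_0,X_1)$ from $\mathbf{Rings}$ to small groupoids, $X_0(R)$ being the objects and $X_1(R)$ the morphisms, with natural maps $\operatorname{dom},\operatorname{codom}:X_1\to X_0$. A map of presheaves of groupoids is a natural transformation. A point of a functor $X:\mathbf{Rings}\to\mathbf{Set}$ is a pair $(R,x)$ with $x\in X(R)$; a map of points $(R,x)\to(S,y)$ is a ring map $f:R\to S$ with $X(f)(x)=y$. A sheaf over $X$ (with respect to $\mathcal T$) is a functorial assignment to each point $(R,x)$ of an $R$-module $M_x$, and to each map of points $f:(R,x)\to(S,y)$ of an $R$-linear map $M_x\to M_y$, such that for each cover $\{R\to S_i\}$ the diagram of $R$-modules $M_x\to\prod_iM_{x_i}\rightrightarrows\prod_{j,k}M_{x_{jk}}$ is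 an equalizer, where $x_i$, $x_{jk}$ are the images of $x$ in $X(S_i)$, $X(S_j\otimes_RS_k)$. A map of sheaves over $X$ is a family of $R$-linear maps $M_x\to N_x$ natural in $(R,x)$. For a natural transformation $\Phi:X\to Y$, $(\Phi^*M)_x=M_{\Phi x}$. A sheaf over $(X_0,X_1)$ is a sheaf $M$ over $X_0$ with an isomorphism $\psi:\operatorname{dom}^*M\to\operatorname{codom}^*M$ of sheaves over $X_1$, so with natural $R$-linear isomorphisms $\psi_\alpha:M_{\operatorname{dom}\alpha}\to M_{\operatorname{codom}\alpha}$ for $\alpha\in X_1(R)$, satisfying $\psi_{\beta\alpha}=\psi_\beta\psi_\alpha$ for composable $\beta,\alpha$. A map $\tau:M\to N$ is a map of sheaves over $X_0$ with $\tau_{\operatorname{codom}\alpha}\psi^M_\alpha=\psi^N_\alpha\tau_{\operatorname{dom}\alpha}$ for all $\alpha$. This is the category $\mathbf{Sh}^{\mathcal T}_{(X_0,X_1)}$. A map $\Phi:(X_0,X_1)\to(Y_0,Y_1)$ induces the functor $\Phi^*$ with $(\Phi^*M)_x=M_{\Phi x}$ and $\psi^{\Phi^*M}_\alpha=\psi^M_{\Phi\alpha}$. The essential image of $\Phi$ consists of the points $(R,y)$ of $Y_0$ for which there are $x\in X_0(R)$ and a morphism $\Phi x\to y$ in $Y_1(R)$. The sheaf-theoretic essential image consists of the points $(R,y)$ of $Y_0$ for which there is a $\mathcal T$-cover $\{f_i:R\to S_i\}$ with each $Y_0(f_i)(y)$ in the essential image. $\Phi$ is an internal equivalence if $\Phi(R)$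 is full and faithful for all $R$ and the sheaf-theoretic essential image of $\Phi$ is all of $Y_0$. *)

(* Defs.v *)
From HB Require Import structures.
From mathcomp Require Import all_boot all_algebra.
From mathcomp Require Import boolp classical_sets functions cardinality.

Set Implicit Arguments.
Unset Strict Implicit.
Unset Printing Implicit Defensive.

Import GRing.Theory.
Local Open Scope ring_scope.
Local Open Scope card_scope.

Lemma rmorph_ext (R S : pzSemiRingType) (f g : {rmorphism R -> S}) :
  f =1 g -> f = g.
Proof.
case: f => f [[f1] [f2]]; case: g => g [[g1] [g2]] /= fg.
have efg : f = g by apply: funext.
case: _ / efg g1 g2 {fg} => g1 g2.
by rewrite (Prop_irrelevance f1 g1) (Prop_irrelevance f2 g2).
Qed.

Lemma linear_ext (R : pzSemiRingType) (U : lSemiModType R) (V : nmodType)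
    (s : R -> V -> V) (f g : {linear U -> V | s}) : f =1 g -> f = g.
Proof.
case: f => f [[f1] [f2]]; case: g => g [[g1] [g2]] /= fg.
have efg : f = g by apply: funext.
case: _ / efg g1 g2 {fg} => g1 g2.
by rewrite (Prop_irrelevance f1 g1) (Prop_irrelevance f2 g2).
Qed.

Record category := Category {
  cobj :> Type;
  chom : cobj -> cobj -> Type;
  cid : forall A, chom A A;
  ccomp : forall A B C, chom B C -> chom A B -> chom A C;
  ccompA : forall A B C D (h : chom C D) (g : chom B C) (f : chom A B),
    ccomp h (ccomp g f) = ccomp (ccomp h g) f;
  ccomp1m : forall A B (f : chom A B), ccomp (cid B) f = f;
  ccompm1 : forall A B (f : chom A B), ccomp f (cid A) = f
}.
Arguments cid {c} A.

Record functor (C D : category) := Functor {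
  fobj :> C -> D;
  fmap : forall A B, chom A B -> chom (fobj A) (fobj B);
  fmap1 : forall A, fmap (cid A) = cid (fobj A);
  fmapM : forall A B E (g : chom B E) (f : chom A B),
    fmap (ccomp g f) = ccomp (fmap g) (fmap f)
}.

Definition id_functor (C : category) : functor C C :=
  @Functor C C id (fun _ _ f => f) (fun _ => erefl) (fun _ _ _ _ _ => erefl).

Definition comp_functor (C D E : category) (G : functor D E) (F : functor C D) :
  functor C E.
Proof.
apply: (@Functor C E (fun A => G (F A)) (fun A B f => fmap G (fmap F f))).
- by move=> A; rewrite !fmap1.
- by move=> A B B' g f; rewrite !fmapM.
Defined.

Definition naturally_isomorphic (C D : category) (F G : functor C D) : Prop :=
  exists (eta : forall A, chom (F A) (G A)) (theta : forall A, chom (G A) (F A)),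
    [/\ forall A B (f : chom A B),
          ccomp (eta B) (fmap F f) = ccomp (fmap G f) (eta A),
        forall A, ccomp (theta A) (eta A) = cid (F A)
      & forall A, ccomp (eta A) (theta A) = cid (G A)].

Definition is_equivalence (C D : category) (F : functor C D) : Prop :=
  exists G : functor D C,
    naturally_isomorphic (comp_functor G F) (id_functor C) /\
    naturally_isomorphic (comp_functor F G) (id_functor D).

Definition card_lt (T U : Type) : Prop :=
  ([set: T] #<= [set: U]) /\ ~ ([set: U] #<= [set: T]).

(* The cardinal kappa is the cardinality of a type K. The zero ring is
   included, hence comPzRingType rather than comNzRingType. *)
Record kring (K : Type) := KRing {
  kring_sort :> comPzRingType;
  kring_card : card_lt kring_sort K
}.

Notation "R ~> S" := {rmorphism R -> S} (at level 70, no associativity).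

(* A single universe for the index sets of all families of ring maps. *)
Definition index_set := Type.

Section Rings.
Variable K : Type.

(* P, with l and r, is the tensor product of S and S' over R: the pushout of
   f and g in the category of rings. *)
Definition is_tensor (R S S' P : kring K)
    (f : R ~> S) (g : R ~> S') (l : S ~> P) (r : S' ~> P) : Prop :=
  (forall a, l (f a) = r (g a)) /\
  forall (Q : kring K) (u : S ~> Q) (v : S' ~> Q),
    (forall a, u (f a) = v (g a)) ->
    exists! w : P ~> Q, (forall s, w (l s) = u s) /\ (forall t, w (r t) = v t).

(* A Grothendieck topology on the opposite of the category of rings, given by
   its covers. Tensor products being defined up to isomorphism only, stability
   under base change is required for every choice of them. *)
Record topology := Topology {
  is_cover : forall (R : kring K) (I : index_set) (S : I -> kring K),
    (forall i, R ~> S i) -> Prop;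
  cover_iso : forall (R S : kring K) (f : R ~> S),
    bijective f -> @is_cover R unit (fun=> S) (fun=> f);
  cover_base : forall (R R' : kring K) (g : R ~> R') (I : index_set)
      (S : I -> kring K) (f : forall i, R ~> S i)
      (P : I -> kring K) (l : forall i, R' ~> P i) (r : forall i, S i ~> P i),
    is_cover f -> (forall i, is_tensor g (f i) (l i) (r i)) -> is_cover l;
  cover_comp : forall (R : kring K) (I : index_set) (S : I -> kring K)
      (f : forall i, R ~> S i) (J : I -> index_set)
      (Q : forall i, J i -> kring K) (g : forall i j, S i ~> Q i j),
    is_cover f -> (forall i, is_cover (g i)) ->
    @is_cover R {i : I & J i} (fun p => Q (tag p) (tagged p))
      (fun p => g (tag p) (tagged p) \o f (tag p))
}.

Record presheaf := Presheaf {
  psh :> kring K -> Type;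
  pmap : forall R S : kring K, (R ~> S) -> psh R -> psh S;
  pmap_id : forall (R : kring K) (x : psh R), pmap idfun x = x;
  pmap_comp : forall (R S Q : kring K) (g : S ~> Q) (f : R ~> S) (x : psh R),
    pmap (g \o f) x = pmap g (pmap f x)
}.

Record presheaf_map (X Y : presheaf) := PresheafMap {
  papp :> forall R : kring K, X R -> Y R;
  papp_nat : forall (R S : kring K) (f : R ~> S) (x : X R),
    papp (pmap f x) = pmap f (papp x)
}.

Lemma tensor_point (X : presheaf) (R S S' P : kring K)
    (f : R ~> S) (g : R ~> S') (l : S ~> P) (r : S' ~> P) (x : X R) :
  is_tensor f g l r -> pmap r (pmap g x) = pmap l (pmap f x).
Proof.
move=> [lfrg _]; rewrite -!pmap_comp; congr (pmap _ x).
by apply: rmorph_ext => a /=; rewrite lfrg.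
Qed.

(* A map of points (R, x) -> (S, y) is a map f together with a proof of
   pmap f x = y, so that restriction along composites needs no transport. The
   last field is the equalizer condition, for every choice of the tensor
   products P j k of S j and S k over R. *)
Record sheaf (T : topology) (X : presheaf) := Sheaf {
  sec :> forall R : kring K, X R -> lmodType R;
  res : forall (R S : kring K) (f : R ~> S) (x : X R) (y : X S),
    pmap f x = y -> {linear sec x -> sec y | f \; *:%R};
  res_id : forall (R : kring K) (x : X R) (xx : pmap idfun x = x) (m : sec x),
    res xx m = m;
  res_comp : forall (R S Q : kring K) (f : R ~> S) (g : S ~> Q)
      (x : X R) (y : X S) (z : X Q) (xy : pmap f x = y) (yz : pmap g y = z)
      (xz : pmap (g \o f) x = z) (m : sec x),
    res xz m = res yz (res xy m);
  sec_equalizer : forall (R : kring K) (I : index_set) (S : I -> kring K)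
      (f : forall i, R ~> S i), is_cover T f ->
    forall (P : I -> I -> kring K)
      (l : forall j k, S j ~> P j k) (r : forall j k, S k ~> P j k)
      (PT : forall j k, is_tensor (f j) (f k) (l j k) (r j k))
      (x : X R) (m : forall i, sec (pmap (f i) x)),
    (forall j k, res (erefl (pmap (l j k) (pmap (f j) x))) (m j)
               = res (tensor_point x (PT j k)) (m k)) ->
    exists! s : sec x, forall i, res (erefl (pmap (f i) x)) s = m i
}.

Record sheaf_map (T : topology) (X : presheaf) (M N : sheaf T X) := SheafMap {
  sapp :> forall (R : kring K) (x : X R), {linear M R x -> N R x};
  sapp_nat : forall (R S : kring K) (f : R ~> S) (x : X R) (y : X S)
      (xy : pmap f x = y) (m : M R x),
    sapp y (res M xy m) = res N xy (sapp x m)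
}.

(* A small groupoid, with a single type of morphisms. *)
Record groupoid := Groupoid {
  gobj : Type;
  gmor : Type;
  gdom : gmor -> gobj;
  gcod : gmor -> gobj;
  gid : gobj -> gmor;
  gcomp : forall b a : gmor, gcod a = gdom b -> gmor;
  ginv : gmor -> gmor;
  gdom_id : forall x, gdom (gid x) = x;
  gcod_id : forall x, gcod (gid x) = x;
  gdom_comp : forall b a (ab : gcod a = gdom b), gdom (gcomp ab) = gdom a;
  gcod_comp : forall b a (ab : gcod a = gdom b), gcod (gcomp ab) = gcod b;
  gcompA : forall a b c (ab : gcod a = gdom b) (bc : gcod b = gdom c)
      (ab_c : gcod (gcomp ab) = gdom c) (a_bc : gcod a = gdom (gcomp bc)),
    gcomp ab_c = gcomp a_bc;
  gcomp1m : forall a (e : gcod a = gdom (gid (gcod a))), gcomp e = a;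
  gcompm1 : forall a (e : gcod (gid (gdom a)) = gdom a), gcomp e = a;
  gdom_inv : forall a, gdom (ginv a) = gcod a;
  gcod_inv : forall a, gcod (ginv a) = gdom a;
  gcompVm : forall a (e : gcod a = gdom (ginv a)), gcomp e = gid (gdom a);
  gcompmV : forall a (e : gcod (ginv a) = gdom a), gcomp e = gid (gcod a)
}.

Definition is_mor (G : groupoid) (x y : gobj G) (a : gmor G) : Prop :=
  gdom a = x /\ gcod a = y.

Record groupoid_functor (G H : groupoid) := GroupoidFunctor {
  gfobj : gobj G -> gobj H;
  gfmor : gmor G -> gmor H;
  gf_dom : forall a, gdom (gfmor a) = gfobj (gdom a);
  gf_cod : forall a, gcod (gfmor a) = gfobj (gcod a);
  gf_id : forall x, gfmor (gid x) = gid (gfobj x);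
  gf_comp : forall b a (ab : gcod a = gdom b)
      (fab : gcod (gfmor a) = gdom (gfmor b)),
    gfmor (gcomp ab) = gcomp fab
}.

Lemma gf_is_mor (G H : groupoid) (F : groupoid_functor G H) x y a :
  is_mor x y a -> is_mor (gfobj F x) (gfobj F y) (gfmor F a).
Proof. by move=> [<- <-]; split; [exact: gf_dom | exact: gf_cod]. Qed.

Record presheaf_of_groupoids := PresheafOfGroupoids {
  pgrp :> kring K -> groupoid;
  pgmap : forall R S : kring K, (R ~> S) -> groupoid_functor (pgrp R) (pgrp S);
  pgmap_id : forall R : kring K,
    (forall x, gfobj (pgmap (idfun : R ~> R)) x = x) /\
    (forall a, gfmor (pgmap (idfun : R ~> R)) a = a);
  pgmap_comp : forall (R S Q : kring K) (g : S ~> Q) (f : R ~> S),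
    (forall x, gfobj (pgmap (g \o f)) x = gfobj (pgmap g) (gfobj (pgmap f) x)) /\
    (forall a, gfmor (pgmap (g \o f)) a = gfmor (pgmap g) (gfmor (pgmap f) a))
}.

Definition objects (X : presheaf_of_groupoids) : presheaf :=
  @Presheaf (fun R => gobj (X R)) (fun R S f => gfobj (pgmap X f))
    (fun R => (pgmap_id X R).1) (fun R S Q g f => (pgmap_comp X g f).1).

Record groupoids_map (X Y : presheaf_of_groupoids) := GroupoidsMap {
  gmap :> forall R : kring K, groupoid_functor (X R) (Y R);
  gmap_obj : forall (R S : kring K) (f : R ~> S) x,
    gfobj (gmap S) (gfobj (pgmap X f) x) = gfobj (pgmap Y f) (gfobj (gmap R) x);
  gmap_mor : forall (R S : kring K) (f : R ~> S) a,
    gfmor (gmap S) (gfmor (pgmap X f) a) = gfmor (pgmap Y f) (gfmor (gmap R) a)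
}.

Definition objects_map (X Y : presheaf_of_groupoids) (Phi : groupoids_map X Y) :
    presheaf_map (objects X) (objects Y) :=
  @PresheafMap (objects X) (objects Y) (fun R => gfobj (Phi R))
    (@gmap_obj X Y Phi).

(* psi a : M_(dom a) -> M_(codom a) is given for all x and y equal to dom a and
   codom a, again to avoid transport. Its naturality for maps
   (R, a) -> (S, pgmap f a) of points of X_1 makes it a map of sheaves
   dom^* M -> codom^* M. *)
Record gsheaf (T : topology) (X : presheaf_of_groupoids) := GSheaf {
  gsh :> sheaf T (objects X);
  psi : forall (R : kring K) (x y : gobj (X R)) (a : gmor (X R)),
    is_mor x y a -> {linear gsh R x -> gsh R y};
  psi_bij : forall (R : kring K) (x y : gobj (X R)) (a : gmor (X R))
      (xy : is_mor x y a), bijective (psi xy);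
  psi_nat : forall (R S : kring K) (f : R ~> S) (x y : gobj (X R))
      (a : gmor (X R)) (xy : is_mor x y a) (x' y' : gobj (X S))
      (xy' : is_mor x' y' (gfmor (pgmap X f) a))
      (xx' : pmap (p := objects X) f x = x')
      (yy' : pmap (p := objects X) f y = y') (m : gsh R x),
    psi xy' (res gsh xx' m) = res gsh yy' (psi xy m);
  psi_comp : forall (R : kring K) (x y z : gobj (X R)) (b a : gmor (X R))
      (ab : gcod a = gdom b) (xy : is_mor x y a) (yz : is_mor y z b)
      (xz : is_mor x z (gcomp ab)) (m : gsh R x),
    psi xz m = psi yz (psi xy m)
}.

Record gsheaf_map (T : topology) (X : presheaf_of_groupoids) (M N : gsheaf T X) :=
  GSheafMap {
  gsapp :> sheaf_map M N;
  gsapp_psi : forall (R : kring K) (x y : gobj (X R)) (a : gmor (X R))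
      (xy : is_mor x y a) (m : M R x),
    gsapp R y (psi M xy m) = psi N xy (gsapp R x m)
}.

Lemma gsheaf_map_ext (T : topology) (X : presheaf_of_groupoids)
    (M N : gsheaf T X) (s t : gsheaf_map M N) :
  (forall R x, s R x =1 t R x) -> s = t.
Proof.
case: s => [[s s1] s2]; case: t => [[t t1] t2] /= st.
have est : s = t.
  by apply: functional_extensionality_dep => R;
     apply: functional_extensionality_dep => x; apply: linear_ext; exact: st.
case: _ / est t1 t2 {st} => t1; rewrite (Prop_irrelevance s1 t1) in s2 * => t2.
by rewrite (Prop_irrelevance s2 t2).
Qed.

Section SheafCategory.
Variables (T : topology) (X : presheaf_of_groupoids).

Definition gsheaf_id (M : gsheaf T X) : gsheaf_map M M :=
  @GSheafMap T X M M
    (@SheafMap T (objects X) M M (fun R x => idfun : {linear M R x -> M R x})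
       (fun _ _ _ _ _ _ _ => erefl))
    (fun _ _ _ _ _ _ => erefl).

Definition gsheaf_comp (M N Q : gsheaf T X)
  (t : gsheaf_map N Q) (s : gsheaf_map M N) : gsheaf_map M Q.
Proof.
unshelve eapply GSheafMap.
- apply: (@SheafMap _ _ M Q (fun R x => t R x \o s R x)).
  by move=> R S f x y xy m /=; rewrite !sapp_nat.
- by move=> R x y a xy m /=; rewrite !gsapp_psi.
Defined.

Definition gsheaf_category : category.
Proof.
apply: (@Category (gsheaf T X) (@gsheaf_map T X) gsheaf_id gsheaf_comp).
- by move=> A B C D h g f; apply: gsheaf_map_ext.
- by move=> A B f; apply: gsheaf_map_ext.
- by move=> A B f; apply: gsheaf_map_ext.
Defined.

End SheafCategory.

Lemma sec_equalizer_along (T : topology) (X : presheaf) (M : sheaf T X)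
    (R : kring K) (I : index_set) (S : I -> kring K) (f : forall i, R ~> S i)
    (P : I -> I -> kring K) (l : forall j k, S j ~> P j k)
    (r : forall j k, S k ~> P j k) :
  is_cover T f -> (forall j k, is_tensor (f j) (f k) (l j k) (r j k)) ->
  forall (x : X R) (y : forall i, X (S i)) (z : forall j k, X (P j k))
    (xy : forall i, pmap (f i) x = y i)
    (lz : forall j k, pmap (l j k) (y j) = z j k)
    (rz : forall j k, pmap (r j k) (y k) = z j k) (m : forall i, M _ (y i)),
  (forall j k, res M (lz j k) (m j) = res M (rz j k) (m k)) ->
  exists! s : M R x, forall i, res M (xy i) s = m i.
Proof.
move=> fT PT x y z xy lz rz m.
have ey : (fun i => pmap (f i) x) = y by apply: functional_extensionality_dep.
case: _ / ey z xy lz rz m => z xy lz rz m.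
have ez : (fun j k => pmap (l j k) (pmap (f j) x)) = z.
  by apply: functional_extensionality_dep => j;
     apply: functional_extensionality_dep => k; exact: lz.
case: _ / ez lz rz => lz rz mP.
have [|s [sm su]] := @sec_equalizer T X M R I S f fT P l r PT x m.
  move=> j k; have := mP j k.
  by rewrite (Prop_irrelevance (lz j k) erefl)
             (Prop_irrelevance (rz j k) (tensor_point x (PT j k))).
exists s; split=> [i|s' s'm]; first by rewrite (Prop_irrelevance (xy i) erefl).
by apply: su => i; rewrite -(s'm i) (Prop_irrelevance (xy i) erefl).
Qed.

Lemma papp_eq (X Y : presheaf) (Phi : presheaf_map X Y) (R S : kring K)
    (f : R ~> S) (x : X R) (y : X S) :
  pmap f x = y -> pmap f (Phi R x) = Phi S y.
Proof. by move=> <-; rewrite papp_nat. Qed.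

Definition sheaf_pullback (T : topology) (X Y : presheaf)
  (Phi : presheaf_map X Y) (M : sheaf T Y) : sheaf T X.
Proof.
apply: (@Sheaf T X (fun R x => M R (Phi R x))
          (fun R S f x y xy => res M (papp_eq Phi xy))).
- by move=> R x xx m; exact: res_id.
- by move=> R S Q f g x y z xy yz xz m; exact: res_comp.
- move=> R I S f fT P l r PT x m mP.
  exact: (sec_equalizer_along fT PT) mP.
Defined.

Section GSheafPullback.
Variables (T : topology) (X Y : presheaf_of_groupoids).
Variable Phi : groupoids_map X Y.

Definition gsheaf_pullback (M : gsheaf T Y) : gsheaf T X.
Proof.
apply: (@GSheaf T X (sheaf_pullback (objects_map Phi) M)
          (fun R x y a xy => psi M (gf_is_mor (Phi R) xy))).
- by move=> R x y a xy; exact: psi_bij.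
- move=> R S f x y a xy x' y' xy' xx' yy' m /=.
  move: (gf_is_mor _ xy') (papp_eq _ _) (papp_eq _ _) => /=.
  by rewrite gmap_mor => h h1 h2; exact: psi_nat.
- move=> R x y z b a ab xy yz xz m.
  have e : gcod (gfmor (Phi R) a) = gdom (gfmor (Phi R) b).
    by rewrite gf_cod gf_dom ab.
  move: (gf_is_mor _ xz); rewrite (gf_comp _ e) => h; exact: psi_comp.
Defined.

Definition gsheaf_pullback_map (M N : gsheaf T Y) (t : gsheaf_map M N) :
  gsheaf_map (gsheaf_pullback M) (gsheaf_pullback N).
Proof.
unshelve eapply GSheafMap.
- apply: (@SheafMap _ _ (gsheaf_pullback M) (gsheaf_pullback N)
            (fun R x => t R (gfobj (Phi R) x))).
  by move=> R S f x y xy m; exact: (sapp_nat t).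
- by move=> R x y a xy m; exact: (gsapp_psi t).
Defined.

Definition pullback_functor :
  functor (gsheaf_category T Y) (gsheaf_category T X).
Proof.
apply: (@Functor (gsheaf_category T Y) (gsheaf_category T X)
          gsheaf_pullback gsheaf_pullback_map).
- by move=> M; apply: gsheaf_map_ext.
- by move=> M N Q t s; apply: gsheaf_map_ext.
Defined.

Definition full_on (R : kring K) : Prop :=
  forall (x x' : gobj (X R)) (b : gmor (Y R)),
    is_mor (gfobj (Phi R) x) (gfobj (Phi R) x') b ->
    exists a : gmor (X R), is_mor x x' a /\ gfmor (Phi R) a = b.

Definition faithful_on (R : kring K) : Prop :=
  forall (x x' : gobj (X R)) (a a' : gmor (X R)),
    is_mor x x' a -> is_mor x x' a' ->
    gfmor (Phi R) a = gfmor (Phi R) a' -> a = a'.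

Definition essential_image (R : kring K) (y : gobj (Y R)) : Prop :=
  exists (x : gobj (X R)) (b : gmor (Y R)), is_mor (gfobj (Phi R) x) y b.

Definition sheaf_essential_image (R : kring K) (y : gobj (Y R)) : Prop :=
  exists (I : index_set) (S : I -> kring K) (f : forall i, R ~> S i),
    is_cover T f /\ forall i, essential_image (gfobj (pgmap Y (f i)) y).

Definition internal_equivalence : Prop :=
  (forall R : kring K, full_on R /\ faithful_on R) /\
  forall (R : kring K) (y : gobj (Y R)), sheaf_essential_image y.

End GSheafPullback.
End Rings.

(* Main.v *)
(* A quasi-inverse of Phi^* is the right Kan extension along Phi: over a point
   (R, y) of Y_0 it takes the module of families n(f, x, b) in M_x, indexed by
   ring maps f : R -> S, x in X_0(S) and b : Phi x -> f y, that are compatible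
   with base change and with precomposition of b by morphisms Phi a. Such
   families glue along covers of R because M is a sheaf and covers are stable
   under base change, which rests on the existence of tensor products of rings of
   cardinality less than kappa. When y = Phi x, full faithfulness makes a family
   determined by its value at (id, x, id), which gives Phi^* Ran M = M. For N over
   Y, the map m |-> (psi_b^-1 (f m)) from N_y to the families is bijective because
   y is, locally on a cover, in the essential image. *)

Require Import Defs.
From HB Require Import structures.
From mathcomp Require Import all_boot all_algebra.
From mathcomp Require Import boolp classical_sets functions cardinality.

Set Implicit Arguments.
Unset Strict Implicit.
Unset Printing Implicit Defensive.

Import GRing.Theory.
Local Open Scope classical_set_scope.
Local Open Scope ring_scope.
Local Open Scope card_scope.

(* [seq.pmap] shadows the action of ring maps on a presheaf. *)
Local Notation pmap := Defs.pmap.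

(** * Infinite cardinals *)

(** Essential surjectivity holds only locally, and the cover and lifts that it provides for a point
    (R, y) are not functorial in that point. Hence the quasi-inverse is a limit over all (f, x, b);
    a chosen cover serves only to cut the carrier down to size and to test equalities. Fullness
    connects any two lifts (x, b) and (x', b') over the same f by a morphism of X, so one lift on
    each member of a cover decides everything there. Faithfulness enters at one point: it makes the
    family built from an element of M_x well defined. Tensor products have to be strictly smaller
    than kappa, so an embedding into [K] is not enough. They are compared instead with the larger of
    the two factors, when that is infinite, which takes the equality of an infinite cardinal with
    its square; finite factors are counted apart. *)

Lemma card_leTP (T U : Type) :
  [set: T] #<= [set: U] <-> exists f : T -> U, injective f.
Proof.
split=> [/card_leP[f]|[f fI]].
  exists (fun x => val (f (SigSub (mem_set (I : [set: T] x))))) => x y /val_inj e.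
  by have /(congr1 val) := 'inj_f (mem_set I) (mem_set I) e.
have /card_eqPle[_ le_im] : f @` [set: T] #= [set: T].
  by apply: inj_card_eq => x y _ _; exact: fI.
exact: card_le_trans le_im (subset_card_le _).
Qed.

(** Zorn yields a maximal graph of a partial bijection between [T] and [U]. If it missed a point on
    each side, that pair could be added; so it is total on one side and gives an injection from
    there. *)
Lemma card_le_totalT (T U : Type) :
  [set: T] #<= [set: U] \/ [set: U] #<= [set: T].
Proof.
pose P (G : set (T * U)) := forall p q, G p -> G q -> p.1 = q.1 <-> p.2 = q.2.
have [F FP Ftot|G [GP Gmax]] := @Zorn_bigcup _ P.
  move=> p q [A FA Ap] [B FB Bq].
  have [AB|BA] := Ftot _ _ FA FB; first exact: FP FB _ _ (AB _ Ap) Bq.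
  exact: FP FA _ _ Ap (BA _ Bq).
have [domT|] := pselect (forall t, exists u, G (t, u)).
  have [f fG] := choice domT; left; apply/card_leTP; exists f => x y fxy.
  exact/(GP _ _ (fG x) (fG y)).
move=> /existsNP[t0 t0G].
have [ranT|] := pselect (forall u, exists t, G (t, u)).
  have [f fG] := choice ranT; right; apply/card_leTP; exists f => x y fxy.
  exact/(GP _ _ (fG x) (fG y)).
move=> /existsNP[u0 u0G].
have [] := Gmax (G `|` [set (t0, u0)]).
  split=> [|GG]; first exact: subsetUl.
  by apply: t0G; exists u0; apply: GG; right.
move=> [t u] [t' u'] [Gp|/= [-> ->]] [Gq|/= [-> ->]] //=; first exact: GP Gp Gq.
  by split=> e; [case: t0G; exists u; rewrite -e|case: u0G; exists t; rewrite -e].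
by split=> e; [case: t0G; exists u'; rewrite e|case: u0G; exists t'; rewrite e].
Qed.

(** * An infinite set absorbs its square *)

Section Square.
Variable A : Type.
Implicit Types G : set (A * A * A).

Definition square_dom G : set A := [set a | exists c, G (a, a, c)].

(* G is the graph of an injection B * B -> B, where B = square_dom G. *)
Definition square_graph G :=
  [/\ forall p q, G p -> G q -> p.1 = q.1 <-> p.2 = q.2,
      forall a b, square_dom G a -> square_dom G b -> exists c, G (a, b, c)
    & forall a b c, G (a, b, c) ->
        [/\ square_dom G a, square_dom G b & square_dom G c]].

(** Each clause of [square_graph] involves at most two triples of [G], so it can be checked inside a
    single [H]. This gives the chain condition of Zorn's lemma. *)
Lemma square_graph_directed G :
  (forall p q, G p -> G q -> exists H, [/\ square_graph H, H `<=` G, H p & H q]) ->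
  square_graph G.
Proof.
move=> Gdir; split=> [p q /Gdir/[apply][[H [[H1 _ _] _ Hp Hq]]]|a b [c ac] [d bd]|].
- exact: H1.
- have [H [[_ H2 _] HG Ha Hb]] := Gdir _ _ ac bd.
  by have [|| e He] := H2 a b; [exists c|exists d|exists e; exact: HG].
- move=> a b c /[dup] Gabc /Gdir/(_ Gabc)[H [[_ _ H3] HG Habc _]].
  by have [[a' ?] [b' ?] [c' ?]] := H3 _ _ _ Habc; split; [exists a'|exists b'|exists c'];
     exact: HG.
Qed.

(** The graph is grown from a pairing on a countable subset, so that its domain contains four
    distinct elements [c i j]; they later serve as tags carrying two bits. *)
Lemma infinite_square_graph : infinite_set [set: A] ->
  exists (G : set (A * A * A)) (c : bool -> bool -> A),
    [/\ square_graph G, forall i j, square_dom G (c i j) &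
        forall i j i' j', c i j = c i' j' -> i = i' /\ j = j'] /\
    forall G', square_graph G' -> G `<=` G' -> G' `<=` G.
Proof.
move=> /infiniteP/card_leTP[n nI].
pose G0 : set (A * A * A) :=
  [set p | exists i j, p = (n i, n j, n (pickle (i, j)))].
have G0n i : square_dom G0 (n i) by exists (n (pickle (i, i))), i, i.
have G0sq : square_graph G0.
  split.
  - move=> _ _ [i [j ->]] [i' [j' ->]] /=; split; first by move=> [/nI-> /nI->].
    by move=> /nI/(pcan_inj pickleK)[-> ->].
  - move=> a b [_ [i [_ [-> _ _]]]] [_ [j [_ [-> _ _]]]].
    by exists (n (pickle (i, j))), i, j.
  - by move=> a b c [i [j [-> -> ->]]]; split; apply: G0n.
(* Taking the union with [G0] handles the empty chain and puts [G0] inside the maximal graph. *)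
have [F FP Ftot|G [GP Gmax]] := @Zorn_bigcup _ (fun G => square_graph (G0 `|` G)).
  apply: square_graph_directed => p q.
  case=> [G0p|[H FH Hp]] [G0q|[H' FH' Hq]].
  - by exists G0; split=> //; exact: subsetUl.
  - exists (G0 `|` H'); split; [exact: FP| |by left|by right].
    by apply: setUS => x ?; exists H'.
  - exists (G0 `|` H); split; [exact: FP| |by right|by left].
    by apply: setUS => x ?; exists H.
  - have [HH|HH] := Ftot _ _ FH FH'.
    + exists (G0 `|` H'); split; [exact: FP| |by right; exact: HH|by right].
      by apply: setUS => x ?; exists H'.
    + exists (G0 `|` H); split; [exact: FP| |by right|by right; exact: HH].
      by apply: setUS => x ?; exists H.
exists (G0 `|` G), (fun i j => n (i.*2 + j)%N); split; first split=> //.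
- by move=> i j; have [c Gc] := G0n (i.*2 + j)%N; exists c; left.
- by move=> [] [] [] [] /nI.
move=> G' G'sq GG'; apply: contrapT => G'G.
apply: (Gmax G'); last by rewrite setUidr// => p ?; apply: GG'; left.
split=> [p ?|GG]; first by apply: GG'; right.
by apply: G'G => p /GG; right.
Qed.

(** With B the domain of [G] and [h] embedding B outside itself, the pairing extends to the union of
    B and h(B). A pair with at least one entry in h(B) is sent into h(B), and the tag [c i j]
    records which entries lie there; so new values avoid the old ones and each other. *)
Lemma square_graph_extend G (c : bool -> bool -> A) (f : A -> A -> A) (h : A -> A) :
  square_graph G -> (forall i j, square_dom G (c i j)) ->
  (forall i j i' j', c i j = c i' j' -> i = i' /\ j = j') ->
  (forall a b, square_dom G a -> square_dom G b -> G (a, b, f a b)) ->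
  (forall a, square_dom G a -> ~ square_dom G (h a)) ->
  (forall a b, square_dom G a -> square_dom G b -> h a = h b -> a = b) ->
  exists G', [/\ square_graph G', G `<=` G' & ~ G' `<=` G].
Proof.
move=> [G1 G2 G3] cG cI fG hG hI.
pose t (i : bool) a := if i then h a else a.
pose N : set (A * A * A) := [set p | exists i j a b,
  [/\ i || j, square_dom G a, square_dom G b &
      p = (t i a, t j b, h (f (f a b) (c i j)))]].
have fD a b : square_dom G a -> square_dom G b -> square_dom G (f a b).
  by move=> Ga Gb; have [] := G3 _ _ _ (fG a b Ga Gb).
have fI a b a' b' : square_dom G a -> square_dom G b -> square_dom G a' ->
    square_dom G b' -> f a b = f a' b' -> a = a' /\ b = b'.
  move=> Ga Gb Ga' Gb' e.
  by have /(_ e)[-> ->] := (G1 _ _ (fG a b Ga Gb) (fG a' b' Ga' Gb')).2.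
have tI i a i' a' : square_dom G a -> square_dom G a' -> t i a = t i' a' ->
    i = i' /\ a = a'.
  case: i i' => -[] //= Ga Ga' e; first by rewrite (hI _ _ Ga Ga' e).
    by case: (hG _ Ga); rewrite e.
  by case: (hG _ Ga'); rewrite -e.
have D' x : square_dom (G `|` N) x <-> exists i a, square_dom G a /\ x = t i a.
  split=> [[y [xy|[i [j [a [b [_ Ga _ [-> _ _]]]]]]]]|[[] [a [Ga ->]]]].
  - by exists false, x; split=> //; exists y.
  - by exists i, a.
  - by exists (h (f (f a a) (c true true))); right; exists true, true, a, a.
  - by have [y ?] := Ga; exists y; left.
exists (G `|` N); split=> [| |GN]; [|exact: subsetUl|].
- split.
  + have mixed p q : G p -> N q -> ~ p.1 = q.1 /\ ~ p.2 = q.2.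
      case: p => -[x y z] /G3[Gx Gy Gz] [i [j [a [b [ij Ga Gb ->]]]]] /=.
      split=> [[ex ey]|ez]; last first.
        by apply: (hG _ (fD _ _ (fD _ _ Ga Gb) (cG i j))); rewrite -ez.
      case: i j ij ex ey => [] [] //= _ ex ey.
      * by apply: (hG a Ga); rewrite -ex.
      * by apply: (hG a Ga); rewrite -ex.
      * by apply: (hG b Gb); rewrite -ey.
    move=> p q [Gp|Np] [Gq|Nq].
    * exact: G1.
    * by have [n1 n2] := mixed _ _ Gp Nq; split.
    * by have [n1 n2] := mixed _ _ Gq Np; split=> e; [case: n1|case: n2].
    * case: Np Nq => i [j [a [b [ij Ga Gb ->]]]] [i' [j' [a' [b' [ij' Ga' Gb' ->]]]]].
      split=> /= [[]|e].
        by move=> /(tI _ _ _ _ Ga Ga')[-> ->] /(tI _ _ _ _ Gb Gb')[-> ->].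
      have {}e := hI _ _ (fD _ _ (fD _ _ Ga Gb) (cG _ _))
                         (fD _ _ (fD _ _ Ga' Gb') (cG _ _)) e.
      have [e1 e2] := fI _ _ _ _ (fD _ _ Ga Gb) (cG _ _) (fD _ _ Ga' Gb') (cG _ _) e.
      have [-> ->] := cI _ _ _ _ e2.
      by have [-> ->] := fI _ _ _ _ Ga Gb Ga' Gb' e1.
  + move=> x y /D'[i [a [Ga ->]]] /D'[j [b [Gb ->]]].
    have [ij|ij] := boolP (i || j).
      by exists (h (f (f a b) (c i j))); right; exists i, j, a, b.
    case: i j ij => [] [] //= _; exists (f a b); left; exact: fG.
  + move=> x y z [/G3[Gx Gy Gz]|[i [j [a [b [ij Ga Gb [-> -> ->]]]]]]].
      by split; apply/D'; [exists false, x|exists false, y|exists false, z].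
    split; apply/D'; [by exists i, a|by exists j, b|exists true].
    by exists (f (f a b) (c i j)); split=> //; exact: fD (fD _ _ Ga Gb) (cG i j).
- have Gc := cG true true; apply: (hG _ Gc).
  exists (h (f (f (c true true) (c true true)) (c true true))); apply: GN.
  by right; exists true, true, (c true true), (c true true).
Qed.

(** Let B be the domain of a maximal square graph. By the extension above B cannot inject into its
    complement, so the complement injects into B. Two tags merge this with the identity of B into an
    injection [e] of all of [A] into B, where pairing is available. *)
Lemma infinite_square :
  infinite_set [set: A] -> [set: A * A] #<= [set: A].
Proof.
move=> /infinite_square_graph[G [c [[Gsq cG cI] Gmax]]].
have [f fG] : {f : A -> A -> A & forall a b,
    square_dom G a -> square_dom G b -> G (a, b, f a b)}.
  have /choice[f fG] : forall p : A * A, exists e,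
      square_dom G p.1 -> square_dom G p.2 -> G (p, e).
    move=> [a b].
    have [[Ga Gb]|nG] := pselect (square_dom G a /\ square_dom G b).
      by have [_ /(_ _ _ Ga Gb)[e ?] _] := Gsq; exists e.
    by exists a => Ga Gb; case: nG.
  by exists (fun a b => f (a, b)) => a b; exact: (fG (a, b)).
pose B := {a | square_dom G a}; pose C := {a | ~ square_dom G a}.
have [/card_leTP[h hI]|/card_leTP[k kI]] := card_le_totalT B C.
  pose h' a := if pselect (square_dom G a) is left Ga then sval (h (exist _ a Ga)) else a.
  have hG a : square_dom G a -> ~ square_dom G (h' a).
    by move=> Ga; rewrite /h'; case: pselect => // Ga'; exact: (svalP (h _)).
  have h'I a b : square_dom G a -> square_dom G b -> h' a = h' b -> a = b.
    rewrite /h' => Ga Gb; case: pselect => // {}Ga; case: pselect => // {}Gb.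
    by move=> e; have /hI[] := eq_sig_hprop (fun _ => @Prop_irrelevance _) _ _ e.
  have [G' [G'sq GG' []]] := square_graph_extend Gsq cG cI fG hG h'I.
  exact: Gmax.
have [G1 G2 G3] := Gsq.
pose e a := if pselect (square_dom G a) is right nGa
  then f (sval (k (exist _ a nGa))) (c true true) else f a (c false false).
have fD a b : square_dom G a -> square_dom G b -> square_dom G (f a b).
  by move=> Ga Gb; have [] := G3 _ _ _ (fG a b Ga Gb).
have fI a b a' b' : square_dom G a -> square_dom G b -> square_dom G a' ->
    square_dom G b' -> f a b = f a' b' -> a = a' /\ b = b'.
  move=> Ga Gb Ga' Gb' ee.
  by have /(_ ee)[-> ->] := (G1 _ _ (fG a b Ga Gb) (fG a' b' Ga' Gb')).2.
have kG x : square_dom G (sval (k x)) by exact: svalP.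
have eD a : square_dom G (e a).
  by rewrite /e; case: pselect => Ga; apply: fD.
have eI : injective e.
  move=> a b; rewrite /e; case: pselect => Ga; case: pselect => Gb ee.
  - by have [|||| ->] := fI _ _ _ _ _ _ _ _ ee.
  - by have [||||_ /cI[]] := fI _ _ _ _ _ _ _ _ ee.
  - by have [||||_ /cI[]] := fI _ _ _ _ _ _ _ _ ee.
  - have [||||kk _] := fI _ _ _ _ _ _ _ _ ee => //.
    by have /kI[] := eq_sig_hprop (fun _ => @Prop_irrelevance _) _ _ kk.
apply/card_leTP; exists (fun p => f (e p.1) (e p.2)) => -[a b] [a' b'] /= ee.
by have [||||/eI-> /eI->] := fI _ _ _ _ _ _ _ _ ee.
Qed.

(** The length is encoded along with the iterated pairing, since [n 0] may itself be the code of a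
    pair. *)
Lemma infinite_seq_card :
  infinite_set [set: A] -> [set: seq A] #<= [set: A].
Proof.
move=> Ainf; have /card_leTP[g gI] := infinite_square Ainf.
have /infiniteP/card_leTP[n nI] := Ainf.
pose e := foldr (fun a b => g (a, b)) (n 0%N).
apply/card_leTP; exists (fun s => g (n (size s), e s)) => s s' /gI[/nI].
elim: s s' => [|a s IHs] [|b s'] //= [ss'] /gI[-> /IHs]; by move=> ->.
Qed.

End Square.

(** * Tensor products of small rings *)

Definition mk_rmorphism (R S : pzSemiRingType) (f : R -> S)
    (fD : nmod_morphism f) (fM : monoid_morphism f) : {rmorphism R -> S} :=
  HB.pack f (GRing.isNmodMorphism.Build R S f fD)
            (GRing.isMonoidMorphism.Build R S f fM).

Section Tensor.
Variables (R S S' : comPzRingType) (f : {rmorphism R -> S}) (g : {rmorphism R -> S'}).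

(** The tensor product is the commutative ring presented by the elements of [S] and [S']: terms
    modulo the congruence [teq]. Zero, one and negation come from [TL 0], [TL 1] and [TL (-1)]. *)
Inductive texp := TL of S | TR of S' | TAdd of texp & texp | TMul of texp & texp.

Inductive teq : texp -> texp -> Prop :=
| teq_refl x : teq x x
| teq_sym x y : teq x y -> teq y x
| teq_trans y x z : teq x y -> teq y z -> teq x z
| teq_add x x' y y' : teq x x' -> teq y y' -> teq (TAdd x y) (TAdd x' y')
| teq_mul x x' y y' : teq x x' -> teq y y' -> teq (TMul x y) (TMul x' y')
| teq_addA x y z : teq (TAdd x (TAdd y z)) (TAdd (TAdd x y) z)
| teq_addC x y : teq (TAdd x y) (TAdd y x)
| teq_add0 x : teq (TAdd (TL 0) x) x
| teq_addN x : teq (TAdd (TMul (TL (-1)) x) x) (TL 0)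
| teq_mulA x y z : teq (TMul x (TMul y z)) (TMul (TMul x y) z)
| teq_mulC x y : teq (TMul x y) (TMul y x)
| teq_mul1 x : teq (TMul (TL 1) x) x
| teq_mulDl x y z : teq (TMul (TAdd x y) z) (TAdd (TMul x z) (TMul y z))
| teq_LD a b : teq (TL (a + b)) (TAdd (TL a) (TL b))
| teq_LM a b : teq (TL (a * b)) (TMul (TL a) (TL b))
| teq_RD a b : teq (TR (a + b)) (TAdd (TR a) (TR b))
| teq_RM a b : teq (TR (a * b)) (TMul (TR a) (TR b))
| teq_R1 : teq (TR 1) (TL 1)
| teq_LR a : teq (TL (f a)) (TR (g a)).

Definition tensor := {C : texp -> Prop | exists t, C = teq t}.

Definition tcl (t : texp) : tensor := exist _ (teq t) (ex_intro _ t erefl).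

Lemma tensor_val_inj (x y : tensor) : sval x = sval y -> x = y.
Proof. by apply: eq_sig_hprop => ?; exact: Prop_irrelevance. Qed.

Lemma tcl_eq t u : teq t u -> tcl t = tcl u.
Proof.
move=> tu; apply: tensor_val_inj; apply: funext => v; apply: propext.
by split; apply: teq_trans => //; apply: teq_sym.
Qed.

Definition trepr (x : tensor) : texp := sval (cid (svalP x)).

Lemma treprK x : tcl (trepr x) = x.
Proof. by apply: tensor_val_inj; rewrite /= -(svalP (cid (svalP x))). Qed.

Lemma teq_repr t : teq (trepr (tcl t)) t.
Proof.
by have /(congr1 sval)/= -> := treprK (tcl t); exact: teq_refl.
Qed.

HB.instance Definition _ := gen_eqMixin tensor.
HB.instance Definition _ := gen_choiceMixin tensor.

Definition tadd x y := tcl (TAdd (trepr x) (trepr y)).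
Definition tmul x y := tcl (TMul (trepr x) (trepr y)).
Definition topp x := tcl (TMul (TL (-1)) (trepr x)).

Lemma tcl_add t u : tadd (tcl t) (tcl u) = tcl (TAdd t u).
Proof. by apply/tcl_eq/teq_add; exact: teq_repr. Qed.

Lemma tcl_mul t u : tmul (tcl t) (tcl u) = tcl (TMul t u).
Proof. by apply/tcl_eq/teq_mul; exact: teq_repr. Qed.

Lemma tcl_opp t : topp (tcl t) = tcl (TMul (TL (-1)) t).
Proof. by apply/tcl_eq/teq_mul; [exact: teq_refl|exact: teq_repr]. Qed.

Let taddA : associative tadd.
Proof.
move=> x y z; rewrite -(treprK x) -(treprK y) -(treprK z) !tcl_add.
exact/tcl_eq/teq_addA.
Qed.
Let taddC : commutative tadd.
Proof. by move=> x y; exact/tcl_eq/teq_addC. Qed.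
Let tadd0 : left_id (tcl (TL 0)) tadd.
Proof. by move=> x; rewrite -(treprK x) tcl_add; exact/tcl_eq/teq_add0. Qed.
Let taddN : left_inverse (tcl (TL 0)) topp tadd.
Proof.
by move=> x; rewrite -(treprK x) tcl_opp tcl_add; exact/tcl_eq/teq_addN.
Qed.
HB.instance Definition _ := GRing.isZmodule.Build tensor taddA taddC tadd0 taddN.

Let tmulA : associative tmul.
Proof.
move=> x y z; rewrite -(treprK x) -(treprK y) -(treprK z) !tcl_mul.
exact/tcl_eq/teq_mulA.
Qed.
Let tmulC : commutative tmul.
Proof. by move=> x y; exact/tcl_eq/teq_mulC. Qed.
Let tmul1 : left_id (tcl (TL 1)) tmul.
Proof. by move=> x; rewrite -(treprK x) tcl_mul; exact/tcl_eq/teq_mul1. Qed.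
Let tmulDl : left_distributive tmul tadd.
Proof.
move=> x y z; rewrite -(treprK x) -(treprK y) -(treprK z).
by rewrite !(tcl_mul, tcl_add); exact/tcl_eq/teq_mulDl.
Qed.
HB.instance Definition _ :=
  GRing.Zmodule_isComPzRing.Build tensor tmulA tmulC tmul1 tmulDl.

Lemma tclD t u : tcl (TAdd t u) = tcl t + tcl u.
Proof. by rewrite -tcl_add. Qed.

Lemma tclM t u : tcl (TMul t u) = tcl t * tcl u.
Proof. by rewrite -tcl_mul. Qed.

Definition tensorl : {rmorphism S -> tensor}.
Proof.
apply: (@mk_rmorphism _ _ (fun s => tcl (TL s))).
  by split=> // a b; rewrite -tclD; exact/tcl_eq/teq_LD.
by split=> // a b; rewrite -tclM; exact/tcl_eq/teq_LM.
Defined.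

Lemma tclRD (a b : S') : tcl (TR (a + b)) = tcl (TR a) + tcl (TR b).
Proof. by rewrite -tclD; exact/tcl_eq/teq_RD. Qed.

Definition tensorr : {rmorphism S' -> tensor}.
Proof.
apply: (@mk_rmorphism _ _ (fun s => tcl (TR s))).
  split=> [|a b]; last exact: tclRD.
  (* That [TR 0] is zero follows from additivity by cancellation. *)
  by apply: (@addrI _ (tcl (TR 0))); rewrite -tclRD !addr0.
by split=> [|a b]; [exact/tcl_eq/teq_R1|rewrite -tclM; exact/tcl_eq/teq_RM].
Defined.

Lemma tensorlr a : tensorl (f a) = tensorr (g a).
Proof. exact: tcl_eq (teq_LR a). Qed.

Lemma tensor_ind (P : tensor -> Prop) :
  (forall s, P (tensorl s)) -> (forall s, P (tensorr s)) ->
  (forall x y, P x -> P y -> P (x + y)) -> (forall x y, P x -> P y -> P (x * y)) ->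
  forall x, P x.
Proof.
move=> PL PR PD PM x; rewrite -(treprK x).
by elim: (trepr x) => [s|s|t Pt u Pu|t Pt u Pu];
   [exact: PL|exact: PR|rewrite tclD; exact: PD|rewrite tclM; exact: PM].
Qed.

Section Universal.
Variables (Q : comPzRingType) (u : {rmorphism S -> Q}) (v : {rmorphism S' -> Q}).
Hypothesis uv : forall a, u (f a) = v (g a).

Fixpoint teval (t : texp) : Q :=
  match t with
  | TL s => u s
  | TR s => v s
  | TAdd t1 t2 => teval t1 + teval t2
  | TMul t1 t2 => teval t1 * teval t2
  end.

Lemma teval_eq t t' : teq t t' -> teval t = teval t'.
Proof.
elim=> {t t'} /=; try by [].
- by move=> x y z _ -> _ ->.
- by move=> x x' y y' _ -> _ ->.
- by move=> x x' y y' _ -> _ ->.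
- by move=> x y z; rewrite addrA.
- by move=> x y; rewrite addrC.
- by move=> x; rewrite rmorph0 add0r.
- by move=> x; rewrite rmorphN rmorph1 mulN1r addNr rmorph0.
- by move=> x y z; rewrite mulrA.
- by move=> x y; rewrite mulrC.
- by move=> x; rewrite rmorph1 mul1r.
- by move=> x y z; rewrite mulrDl.
- exact: rmorphD.
- exact: rmorphM.
- exact: rmorphD.
- exact: rmorphM.
- by rewrite !rmorph1.
Qed.

Lemma teval_cl t : teval (trepr (tcl t)) = teval t.
Proof. exact/teval_eq/teq_repr. Qed.

Definition tensor_univ : {rmorphism tensor -> Q}.
Proof.
apply: (@mk_rmorphism _ _ (fun x => teval (trepr x))).
  by split=> [|x y]; rewrite teval_cl//= rmorph0.
by split=> [|x y]; rewrite teval_cl//= rmorph1.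
Defined.

Lemma tensor_univl s : tensor_univ (tensorl s) = u s.
Proof. exact: teval_cl. Qed.

Lemma tensor_univr s : tensor_univ (tensorr s) = v s.
Proof. exact: teval_cl. Qed.

End Universal.

(** Counting terms would not do, as there are infinitely many of them even over finite rings; sums
    of pure tensors give the bound in both the finite and the infinite case. *)
Lemma tensor_span x :
  exists e : seq (S * S'), x = \sum_(p <- e) tensorl p.1 * tensorr p.2.
Proof.
elim/tensor_ind: x => [s|s|_ _ [e1 ->] [e2 ->]|_ _ [e1 ->] [e2 ->]].
- by exists [:: (s, 1)]; rewrite big_seq1 rmorph1 mulr1.
- by exists [:: (1, s)]; rewrite big_seq1 rmorph1 mul1r.
- by exists (e1 ++ e2); rewrite big_cat.
- exists [seq (p.1 * q.1, p.2 * q.2) | p <- e1, q <- e2].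
  rewrite big_allpairs_dep mulr_suml; apply: eq_bigr => p _.
  by rewrite mulr_sumr; apply: eq_bigr => q _; rewrite !rmorphM mulrACA.
Qed.

(** Collecting a sum of pure tensors by right factor writes every element as the sum over [t] in
    [S'] of the tensors of [c t] and [t], for a function [c] from [S'] to [S]. *)
Lemma tensor_finite :
  finite_set [set: S] -> finite_set [set: S'] -> finite_set [set: tensor].
Proof.
move=> finS /finite_seqP[e0 eE].
(* Each [t] must occur once, so that a further pure tensor is absorbed by changing [c] at one
   point. *)
pose e := undup e0; have eT t : t \in e.
  by rewrite mem_undup; have : [set: S'] t by []; rewrite eE.
have fin (e' : seq S') : finite_set
    [set \sum_(t <- e') tensorl (c t) * tensorr t | c in [set: S' -> S]].
  elim: e' => [|t e' IHe].
    apply: (sub_finite_set (B := [set 0])) => [_ [c _ <-]|]; last exact: finite_set1.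
    by rewrite big_nil.
  apply: (sub_finite_set (B := [set x.1 + x.2 | x in
      (fun s => tensorl s * tensorr t) @` [set: S] `*`
      [set \sum_(t <- e') tensorl (c t) * tensorr t | c in [set: S' -> S]]])).
    move=> _ [c _ <-]; rewrite big_cons.
    exists (tensorl (c t) * tensorr t, \sum_(t <- e') tensorl (c t) * tensorr t) => //=.
    by split; [exists (c t)|exists c].
  by apply/finite_image/finite_setX => //; exact: finite_image.
apply: sub_finite_set (fin e) => x _.
have [d ->] := tensor_span x; elim: d => [|[s t] d [c _ cE]].
  exists (fun=> 0) => //; rewrite big_nil big1// => t _.
  by rewrite rmorph0 mul0r.
exists (fun t' => (if t' == t then s else 0) + c t') => //.
rewrite big_cons -cE.
rewrite (eq_bigr (fun t' => tensorl (if t' == t then s else 0) * tensorr t' +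
                            tensorl (c t') * tensorr t')) => [|t' _]; last first.
  by rewrite rmorphD mulrDl.
rewrite big_split; congr (_ + _).
rewrite (bigD1_seq t) ?undup_uniq// eqxx big1; first exact: addr0.
by move=> t' /negPf ->; rewrite rmorph0 mul0r.
Qed.

Lemma tensor_infinite (A : Type) : infinite_set [set: A] ->
  [set: S] #<= [set: A] -> [set: S'] #<= [set: A] -> [set: tensor] #<= [set: A].
Proof.
move=> Ainf /card_leTP[i iI] /card_leTP[j jI].
have AAinf : infinite_set [set: A * A].
  apply: contra_not Ainf; apply: card_le_finite; apply/card_leTP.
  by exists (fun a => (a, a)) => a b [].
have [d dE] := choice tensor_span.
apply: card_le_trans (infinite_square Ainf).
apply: card_le_trans (infinite_seq_card AAinf).
apply/card_leTP; exists (fun x => [seq (i p.1, j p.2) | p <- d x]) => x y.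
move=> /(inj_map _) xy; rewrite (dE x) (dE y) xy// => -[s t] [s' t'] /=.
by move=> [/iI-> /jI->].
Qed.

End Tensor.

(** If [S] or [S'] is infinite, the larger of the two bounds the tensor product and already lies
    strictly below [K]. If both are finite, so is the tensor product, while [K] is infinite. *)
Lemma kring_tensor (K : Type) (R S S' : kring K) (f : R ~> S) (g : R ~> S') :
  infinite_set [set: K] ->
  exists (P : kring K) (l : S ~> P) (r : S' ~> P), is_tensor f g l r.
Proof.
move=> Kinf.
have small : card_lt (tensor f g) K.
  have [SK KS] := kring_card S; have [S'K KS'] := kring_card S'.
  have [finS|infS] := pselect (finite_set [set: S]); last first.
    suff [A [infA AK KA SA S'A]] : exists A : kring K, [/\ infinite_set [set: A],
        [set: A] #<= [set: K], ~ ([set: K] #<= [set: A]),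
        [set: S] #<= [set: A] & [set: S'] #<= [set: A]].
      have TA := tensor_infinite f g infA SA S'A.
      split; first exact: card_le_trans TA AK.
      by move=> KT; apply: KA; exact: card_le_trans KT TA.
    have [SS'|S'S] := card_le_totalT S S'; last by exists S.
    exists S'; split=> //; apply: contra_not infS; exact: card_le_finite.
  have [finS'|infS'] := pselect (finite_set [set: S']).
    have finT := tensor_finite f g finS finS'.
    have [//|KT] := card_le_totalT (tensor f g) K; last first.
      by case: Kinf; exact: card_le_finite KT finT.
    by split=> // KT; case: Kinf; exact: card_le_finite KT finT.
  have [SS'|S'S] := card_le_totalT S S'; last first.
    by case: infS'; exact: card_le_finite S'S finS.
  have TA := tensor_infinite f g infS' SS' (card_lexx _).
  split; first exact: card_le_trans TA S'K.
  by move=> KT; apply: KS'; exact: card_le_trans KT TA.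
exists (KRing small), (tensorl f g), (tensorr f g); split=> [|Q u v uv].
  exact: tensorlr.
exists (tensor_univ uv); split=> [|w [wl wr]].
  by split=> s; [exact: tensor_univl|exact: tensor_univr].
apply: rmorph_ext; apply: tensor_ind => [s|s|x y ex ey|x y ex ey].
- by rewrite tensor_univl wl.
- by rewrite tensor_univr wr.
- by rewrite !rmorphD ex ey.
- by rewrite !rmorphM ex ey.
Qed.

(** * Sheaves and sieves *)

Lemma nmod_morphismP (U V : zmodType) (f : U -> V) :
  {morph f : u v / u + v} -> nmod_morphism f.
Proof. by move=> fD; split=> //; apply: (@addrI _ (f 0)); rewrite -fD !addr0. Qed.

Definition mk_linear (R : pzRingType) (U : lmodType R) (V : zmodType)
    (s : R -> V -> V) (f : U -> V)
    (fD : {morph f : u v / u + v}) (fZ : scalable_for s f) :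
    {linear U -> V | s} :=
  HB.pack f (GRing.isNmodMorphism.Build U V f (nmod_morphismP fD))
            (GRing.isScalable.Build R U V s f fZ).

Section Sieves.
Variables (K : Type) (T : topology K).
Hypothesis K_infinite : infinite_set [set: K].

Lemma cover_base_change (R R' : kring K) (h : R ~> R') (I : index_set)
    (S : I -> kring K) (f : forall i, R ~> S i) : is_cover T f ->
  exists (Q : I -> kring K) (l : forall i, R' ~> Q i) (r : forall i, S i ~> Q i),
    is_cover T l /\ forall i, is_tensor h (f i) (l i) (r i).
Proof.
move=> fT; pose P i := cid (kring_tensor h (f i) K_infinite).
pose L i := cid (svalP (P i)); pose r i := cid (svalP (L i)).
exists (fun i => sval (P i)), (fun i => sval (L i)), (fun i => sval (r i)).
have PT i : is_tensor h (f i) (sval (L i)) (sval (r i)) := svalP (r i).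
by split=> //; exact: cover_base fT PT.
Qed.

(* The pullback along h of the sieve generated by the cover f. *)
Definition in_sieve (R : kring K) (I : index_set) (S : I -> kring K)
    (f : forall i, R ~> S i) (R' : kring K) (h : R ~> R') (Q : kring K)
    (t : R' ~> Q) : Prop :=
  exists (i : I) (s : S i ~> Q), forall a, t (h a) = s (f i a).

(** The cover [f] is base changed along [h] to a cover [l] of [R']. The members of [l] and their
    tensor products lie in the sieve, so the sheaf axiom glues there; any [t] in the sieve factors
    through some [l i] by the universal property, which fixes its value. This form hides the choice
    of tensor products from later arguments. *)
Lemma sheaf_sieve (X : presheaf K) (M : sheaf T X) (R : kring K) (I : index_set)
    (S : I -> kring K) (f : forall i, R ~> S i) (R' : kring K) (h : R ~> R')
    (x : X R')
    (m : forall (Q : kring K) (t : R' ~> Q), in_sieve f h t -> M Q (pmap t x)) :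
  is_cover T f ->
  (forall (Q Q' : kring K) (t : R' ~> Q) (u : Q ~> Q') st st'
     (e : pmap u (pmap t x) = pmap (u \o t) x),
     m Q' (u \o t) st' = res M e (m Q t st)) ->
  exists! s : M R' x, forall (Q : kring K) (t : R' ~> Q) (st : in_sieve f h t),
    res M erefl s = m Q t st.
Proof.
move=> fT mP.
(* The compatibility is restated for any [t'] that agrees pointwise with [u \o t], to confine
   transport along equal ring maps to this place. *)
have {}mP (Q Q' : kring K) (t : R' ~> Q) (u : Q ~> Q') (t' : R' ~> Q') st st'
     (e : pmap u (pmap t x) = pmap t' x) : (forall a, t' a = u (t a)) ->
     m Q' t' st' = res M e (m Q t st).
  move=> tE; have {}tE : t' = u \o t by exact: rmorph_ext.
  by case: _ / (esym tE) st' e => st' e; exact: mP.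
have [Q [l [r [lT PT]]]] := cover_base_change h fT.
have sl i : in_sieve f h (l i) by exists i, (r i) => a; rewrite (PT i).1.
pose P j k := cid (kring_tensor (l j) (l k) K_infinite).
pose L j k := cid (svalP (P j k)); pose U j k := cid (svalP (L j k)).
have PPT j k : is_tensor (l j) (l k) (sval (L j k)) (sval (U j k)).
  exact: svalP (U j k).
have lz j k : pmap (sval (L j k)) (pmap (l j) x) = pmap (sval (L j k) \o l j) x.
  by rewrite pmap_comp.
have rz j k : pmap (sval (U j k)) (pmap (l k) x) = pmap (sval (L j k) \o l j) x.
  by rewrite -lz; exact: tensor_point.
have [|s [sE sU]] := sec_equalizer_along lT PPT (M := M) (fun i => erefl)
  (lz := lz) (rz := rz) (m := fun i => m _ _ (sl i)).
  move=> j k.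
  have st : in_sieve f h (sval (L j k) \o l j).
    by exists j, (sval (L j k) \o r j) => a /=; rewrite (PT j).1.
  rewrite -(mP _ _ _ _ _ (sl j) st)// -(mP _ _ _ _ _ (sl k) st)// => a.
  exact: (PPT j k).1.
exists s; split=> [Q' t [i [u tu]]|s' s'E]; last by apply: sU => i; exact: s'E.
have [w [[wl wr] _]] := (PT i).2 Q' t u tu.
have e : pmap w (pmap (l i) x) = pmap t x.
  by rewrite -pmap_comp; congr pmap; exact: rmorph_ext.
rewrite (mP _ _ _ w _ (sl i) _ e)// -sE.
have tw : t = w \o l i by apply: rmorph_ext => a /=; rewrite wl.
by case: _ / (esym tw) e => e; exact: res_comp.
Qed.

Lemma sheaf_sep (X : presheaf K) (M : sheaf T X) (R : kring K) (I : index_set)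
    (S : I -> kring K) (f : forall i, R ~> S i) (R' : kring K) (h : R ~> R')
    (x : X R') (s s' : M R' x) : is_cover T f ->
  (forall (Q : kring K) (t : R' ~> Q), in_sieve f h t ->
     res M (erefl (pmap t x)) s = res M erefl s') ->
  s = s'.
Proof.
move=> fT ss'.
have [|r [_ rU]] := sheaf_sieve (M := M) (h := h) (x := x)
   (m := fun Q t _ => res M erefl s) fT.
  by move=> Q Q' t u _ _ e; rewrite -(res_comp erefl e erefl).
by rewrite -(rU s)// -(rU s')// => Q t st; rewrite ss'.
Qed.

End Sieves.

(* Composition, made total with a junk value on noncomposable pairs. *)
Definition gmul (G : groupoid) (b a : gmor G) : gmor G :=
  if pselect (gcod a = gdom b) is left e then gcomp e else b.

Lemma gmulE (G : groupoid) (b a : gmor G) (e : gcod a = gdom b) :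
  gmul b a = gcomp e.
Proof.
by rewrite /gmul; case: pselect => // e'; rewrite (Prop_irrelevance e' e).
Qed.

(** * Groupoid identities for the total composition *)

Section Laws.
Variable G : groupoid.
Implicit Types (x y z w : gobj G) (a b c : gmor G).

Lemma is_mor_id x : is_mor x x (gid x).
Proof. by split; [exact: gdom_id|exact: gcod_id]. Qed.

Lemma is_mor_inv x y a : is_mor x y a -> is_mor y x (ginv a).
Proof. by move=> [<- <-]; split; [exact: gdom_inv|exact: gcod_inv]. Qed.

Lemma is_mor_mul x y z a b :
  is_mor x y a -> is_mor y z b -> is_mor x z (gmul b a).
Proof.
move=> [<- ay] [yb <-]; have e : gcod a = gdom b by rewrite ay yb.
by rewrite (gmulE e); split; [exact: gdom_comp|exact: gcod_comp].
Qed.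

Lemma gmulA x y z w a b c : is_mor x y a -> is_mor y z b -> is_mor z w c ->
  gmul c (gmul b a) = gmul (gmul c b) a.
Proof.
move=> [ax ay] [by_ bz] [cz cw].
have ab : gcod a = gdom b by rewrite ay by_.
have bc : gcod b = gdom c by rewrite bz cz.
have ab_c : gcod (gcomp ab) = gdom c by rewrite gcod_comp.
have a_bc : gcod a = gdom (gcomp bc) by rewrite gdom_comp.
rewrite (gmulE ab) (gmulE bc) (gmulE ab_c) (gmulE a_bc); exact: gcompA.
Qed.

Lemma gmul1m x y a : is_mor x y a -> gmul (gid y) a = a.
Proof.
move=> [_ <-]; have e : gcod a = gdom (gid (gcod a)) by rewrite gdom_id.
by rewrite (gmulE e) gcomp1m.
Qed.

Lemma gmulm1 x y a : is_mor x y a -> gmul a (gid x) = a.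
Proof.
move=> [<- _]; have e : gcod (gid (gdom a)) = gdom a by rewrite gcod_id.
by rewrite (gmulE e) gcompm1.
Qed.

Lemma gmulVm x y a : is_mor x y a -> gmul (ginv a) a = gid x.
Proof.
move=> [<- _]; have e : gcod a = gdom (ginv a) by rewrite gdom_inv.
by rewrite (gmulE e) gcompVm.
Qed.

Lemma gmulmV x y a : is_mor x y a -> gmul a (ginv a) = gid y.
Proof.
move=> [_ <-]; have e : gcod (ginv a) = gdom a by rewrite gcod_inv.
by rewrite (gmulE e) gcompmV.
Qed.

Lemma gmulKV x y z a b : is_mor x y a -> is_mor z y b ->
  gmul a (gmul (ginv a) b) = b.
Proof.
move=> xy zy; have yx := is_mor_inv xy.
by rewrite (gmulA zy yx xy) (gmulmV xy) (gmul1m zy).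
Qed.

Lemma gmulK x y z a b : is_mor x y a -> is_mor z x b ->
  gmul (ginv a) (gmul a b) = b.
Proof.
move=> xy zx; have yx := is_mor_inv xy.
by rewrite (gmulA zx xy yx) (gmulVm xy) (gmul1m zx).
Qed.

Lemma gmulI x y z a b b' : is_mor x y a -> is_mor z x b -> is_mor z x b' ->
  gmul a b = gmul a b' -> b = b'.
Proof. by move=> xy zx zx' e; rewrite -(gmulK xy zx) e (gmulK xy zx'). Qed.

Lemma ginv_uniq x y a b : is_mor x y a -> is_mor y x b ->
  gmul a b = gid y -> b = ginv a.
Proof.
move=> xy yx ab; apply: (gmulI xy yx (is_mor_inv xy)).
by rewrite ab (gmulmV xy).
Qed.

Lemma ginvM x y z a b : is_mor x y a -> is_mor y z b ->
  ginv (gmul b a) = gmul (ginv a) (ginv b).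
Proof.
move=> xy yz; have yx := is_mor_inv xy; have zy := is_mor_inv yz.
apply/esym/(ginv_uniq (is_mor_mul xy yz) (is_mor_mul zy yx)).
rewrite (gmulA zy yx (is_mor_mul xy yz)) -(gmulA yx xy yz) (gmulmV xy).
by rewrite (gmulm1 yz) (gmulmV yz).
Qed.

Lemma ginvK x y a : is_mor x y a -> ginv (ginv a) = a.
Proof.
move=> xy; apply/esym/(ginv_uniq (is_mor_inv xy) xy).
exact: gmulVm xy.
Qed.

End Laws.

Lemma gf_mul (G H : groupoid) (F : groupoid_functor G H) x y z a b :
  is_mor x y a -> is_mor y z b ->
  gfmor F (gmul b a) = gmul (gfmor F b) (gfmor F a).
Proof.
move=> [_ ay] [yb _]; have e : gcod a = gdom b by rewrite ay yb.
have Fe : gcod (gfmor F a) = gdom (gfmor F b) by rewrite gf_cod gf_dom e.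
by rewrite (gmulE e) (gmulE Fe); exact: gf_comp.
Qed.

Lemma gf_inv (G H : groupoid) (F : groupoid_functor G H) x y a :
  is_mor x y a -> gfmor F (ginv a) = ginv (gfmor F a).
Proof.
move=> xy; have yx := is_mor_inv xy.
apply: (ginv_uniq (gf_is_mor F xy) (gf_is_mor F yx)).
by rewrite -(gf_mul F yx xy) (gmulmV xy) gf_id.
Qed.

Section GSheafTheory.
Variables (K : Type) (T : topology K) (X : presheaf_of_groupoids K).
Variables (M : gsheaf T X) (R : kring K).
Implicit Types (x y z : gobj (X R)) (a b : gmor (X R)).

Lemma psi_irr x y a b (xy : is_mor x y a) (xy' : is_mor x y b) (m : M R x) :
  a = b -> psi M xy m = psi M xy' m.
Proof. by move=> ab; case: _ / ab xy' => xy'; rewrite (Prop_irrelevance xy xy'). Qed.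

Lemma psi_mul x y z a b (xy : is_mor x y a) (yz : is_mor y z b)
    (xz : is_mor x z (gmul b a)) (m : M R x) :
  psi M xz m = psi M yz (psi M xy m).
Proof.
have e : gcod a = gdom b by rewrite xy.2 yz.1.
by move: xz; rewrite (gmulE e) => xz; exact: psi_comp.
Qed.

(** Compatibility with composition makes [psi] at an identity idempotent, and an idempotent
    bijection is the identity. *)
Lemma psi_id x (xx : is_mor x x (gid x)) (m : M R x) : psi M xx m = m.
Proof.
apply: (bij_inj (psi_bij M xx)).
have xx' : is_mor x x (gmul (gid x) (gid x)) by rewrite (gmul1m xx).
rewrite -(psi_mul xx xx xx'); apply: psi_irr; exact: gmul1m xx.
Qed.

End GSheafTheory.

(** * Right Kan extension *)

Section Families.
Variables (K : Type) (T : topology K) (X Y : presheaf_of_groupoids K).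
Variables (Phi : groupoids_map X Y) (M : gsheaf T X).

(** The tuples (S, f, x, b) are the objects of the comma category over which the Kan extension is a
    limit. *)
Definition lies_over (R : kring K) (y : gobj (Y R)) (S : kring K) (f : R ~> S)
    (x : gobj (X S)) (b : gmor (Y S)) : Prop :=
  is_mor (gfobj (Phi S) x) (gfobj (pgmap Y f) y) b.

Lemma over_push (R S S' : kring K) (y : gobj (Y R)) (f : R ~> S) (g : S ~> S')
    (f' : R ~> S') x b : (forall a, f' a = g (f a)) ->
  lies_over y f x b -> lies_over y f' (gfobj (pgmap X g) x) (gfmor (pgmap Y g) b).
Proof.
move=> fE xb; have -> : f' = g \o f by exact: rmorph_ext.
by rewrite /lies_over gmap_obj (pgmap_comp Y g f).1; exact: gf_is_mor.
Qed.

Lemma over_res (R R' S : kring K) (g : R ~> R') (y : gobj (Y R)) y'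
    (f : R' ~> S) x b :
  pmap (p := objects Y) g y = y' -> lies_over y' f x b -> lies_over y (f \o g) x b.
Proof. by rewrite /lies_over (pgmap_comp Y f g).1 => <-. Qed.

Lemma over_tr (R S : kring K) (y y' : gobj (Y R)) c (f : R ~> S) x b :
  is_mor y y' c -> lies_over y f x b -> lies_over y' f x (gmul (gfmor (pgmap Y f) c) b).
Proof. by move=> yy' xb; apply: is_mor_mul xb (gf_is_mor _ yy'). Qed.

(* The elements over y of the right Kan extension of M along Phi. *)
Record kan_family (R : kring K) (y : gobj (Y R)) := KanFamily {
  fval :> forall (S : kring K) (f : R ~> S) (x : gobj (X S)) (b : gmor (Y S)),
    lies_over y f x b -> M S x;
  fval_res : forall (S S' : kring K) (f : R ~> S) (g : S ~> S') x x' b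
      (xb : lies_over y f x b) (xb' : lies_over y (g \o f) x' (gfmor (pgmap Y g) b))
      (e : pmap (p := objects X) g x = x'),
    fval xb' = res M e (fval xb);
  fval_psi : forall (S : kring K) (f : R ~> S) x x' a b (xx' : is_mor x x' a)
      (xb : lies_over y f x (gmul b (gfmor (Phi S) a))) (xb' : lies_over y f x' b),
    fval xb' = psi M xx' (fval xb)
}.

Section FamilyTheory.
Variables (R : kring K) (y : gobj (Y R)).
Implicit Types n p : kan_family y.

Lemma family_ext n p :
  (forall (S : kring K) (f : R ~> S) x b (xb : lies_over y f x b),
     n S f x b xb = p S f x b xb) -> n = p.
Proof.
case: n => n n1 n2; case: p => p p1 p2 /= np.
have e : n = p.
  apply: functional_extensionality_dep => S; apply: functional_extensionality_dep => f.
  apply: functional_extensionality_dep => x; apply: functional_extensionality_dep => b.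
  by apply: functional_extensionality_dep => xb.
case: _ / e p1 p2 {np} => p1 p2.
by rewrite (Prop_irrelevance n1 p1) (Prop_irrelevance n2 p2).
Qed.

(** The type of a value depends on [f] and [b] through the proof of [lies_over]. This and the next
    two lemmas accept these indices up to equality, so that later steps need no transport. *)
Lemma fval_irr n (S : kring K) (f f' : R ~> S) x b b'
    (xb : lies_over y f x b) (xb' : lies_over y f' x b') :
  (forall a, f' a = f a) -> b' = b -> n S f' x b' xb' = n S f x b xb.
Proof.
move=> fE be; have {}fE : f' = f by exact: rmorph_ext.
case: _ / (esym fE) xb' => xb'; case: _ / (esym be) xb' => xb'.
by rewrite (Prop_irrelevance xb xb').
Qed.

Lemma fval_push n (S S' : kring K) (f : R ~> S) (f' : R ~> S') (g : S ~> S') x x'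
    b b' (xb : lies_over y f x b) (xb' : lies_over y f' x' b')
    (e : pmap (p := objects X) g x = x') :
  (forall a, f' a = g (f a)) -> b' = gfmor (pgmap Y g) b ->
  n S' f' x' b' xb' = res M e (n S f x b xb).
Proof.
move=> fE be; have xb'' : lies_over y (g \o f) x' (gfmor (pgmap Y g) b).
  by move: e => /= <-; exact: over_push xb.
by rewrite -(fval_res n xb xb''); exact: fval_irr.
Qed.

Lemma fval_mor n (S : kring K) (f : R ~> S) x x' a b b' (xx' : is_mor x x' a)
    (xb : lies_over y f x b) (xb' : lies_over y f x' b') :
  b = gmul b' (gfmor (Phi S) a) -> n S f x' b' xb' = psi M xx' (n S f x b xb).
Proof. by move=> be; case: _ / (esym be) xb => xb; exact: fval_psi. Qed.

Definition fam_add n p : kan_family y.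
Proof.
apply: (@KanFamily R y (fun S f x b xb => n S f x b xb + p S f x b xb)).
- by move=> S S' f g x x' b xb xb' e; rewrite !(fval_res _ xb xb' e) linearD.
- by move=> S f x x' a b xx' xb xb'; rewrite !(fval_psi _ xx' xb xb') linearD.
Defined.

Definition fam_opp n : kan_family y.
Proof.
apply: (@KanFamily R y (fun S f x b xb => - n S f x b xb)).
- by move=> S S' f g x x' b xb xb' e; rewrite (fval_res _ xb xb' e) linearN.
- by move=> S f x x' a b xx' xb xb'; rewrite (fval_psi _ xx' xb xb') linearN.
Defined.

Definition fam_zero : kan_family y.
Proof.
apply: (@KanFamily R y (fun S f x b xb => 0)).
- by move=> S S' f g x x' b xb xb' e; rewrite linear0.
- by move=> S f x x' a b xx' xb xb'; rewrite linear0.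
Defined.

Definition fam_scale (r : R) n : kan_family y.
Proof.
apply: (@KanFamily R y (fun S f x b xb => f r *: n S f x b xb)).
- by move=> S S' f g x x' b xb xb' e; rewrite (fval_res _ xb xb' e) linearZ.
- by move=> S f x x' a b xx' xb xb'; rewrite (fval_psi _ xx' xb xb') linearZ.
Defined.

End FamilyTheory.

Definition fam_res (R R' : kring K) (g : R ~> R') (y : gobj (Y R)) y'
    (e : pmap (p := objects Y) g y = y') (n : kan_family y) : kan_family y'.
Proof.
apply: (@KanFamily R' y' (fun S f x b xb => n S (f \o g) x b (over_res e xb))).
- by move=> S S' f h x x' b xb xb' xx'; exact: fval_push.
- by move=> S f x x' a b xx' xb xb'; exact: fval_psi.
Defined.

(** Families are pulled back along [c], against its direction; this is why [kan_psi] uses the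
    inverse morphism. *)
Definition fam_tr (R : kring K) (y y' : gobj (Y R)) c (yy' : is_mor y y' c)
    (n : kan_family y') : kan_family y.
Proof.
apply: (@KanFamily R y (fun S f x b xb =>
          n S f x (gmul (gfmor (pgmap Y f) c) b) (over_tr yy' xb))).
- move=> S S' f g x x' b xb xb' xx'; apply: fval_push => //.
  by rewrite (pgmap_comp Y g f).2 (gf_mul _ xb (gf_is_mor _ yy')).
- move=> S f x x' a b xx' xb xb'; apply: fval_mor.
  by rewrite (gmulA (gf_is_mor _ xx') xb' (gf_is_mor _ yy')).
Defined.

End Families.

Arguments lies_over {K X Y} Phi {R} y {S} f x b.

(** * Separation and gluing of families under an internal equivalence *)

Section Extension.
Variables (K : Type) (T : topology K) (X Y : presheaf_of_groupoids K).
Variable Phi : groupoids_map X Y.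
Hypothesis K_infinite : infinite_set [set: K].
Hypothesis Phi_equiv : internal_equivalence T Phi.

(** Following [b] by the inverse of [b'] gives a morphism from Phi x to Phi x', which fullness
    lifts. *)
Lemma over_full (R S : kring K) (y : gobj (Y R)) (f : R ~> S) x x' b b' :
  lies_over Phi y f x b -> lies_over Phi y f x' b' ->
  exists a, is_mor x x' a /\ b = gmul b' (gfmor (Phi S) a).
Proof.
move=> xb xb'; have [a [xx' aE]] :=
  (Phi_equiv.1 S).1 x x' _ (is_mor_mul xb (is_mor_inv xb')).
by exists a; split=> //; rewrite aE (gmulKV xb' xb).
Qed.

Record ess_cover (R : kring K) (y : gobj (Y R)) := EssCover {
  ec_idx : index_set;
  ec_ring : ec_idx -> kring K;
  ec_map : forall i, R ~> ec_ring i;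
  ec_obj : forall i, gobj (X (ec_ring i));
  ec_mor : forall i, gmor (Y (ec_ring i));
  ec_cover : is_cover T ec_map;
  ec_over : forall i, lies_over Phi y (ec_map i) (ec_obj i) (ec_mor i)
}.

Lemma ess_cover_exists (R : kring K) (y : gobj (Y R)) :
  exists c : ess_cover y, True.
Proof.
have [I [S [f [fT fE]]]] := Phi_equiv.2 R y.
pose x i := cid (fE i); pose b i := cid (svalP (x i)).
by exists (@EssCover R y I S f (fun i => sval (x i)) (fun i => sval (b i)) fT
             (fun i => svalP (b i))).
Qed.

Definition ess_cov (R : kring K) (y : gobj (Y R)) : ess_cover y :=
  sval (cid (ess_cover_exists y)).

(** To compare values at (f, x, b), the cover is pulled back along [f]. On a member of that sieve,
    the restriction of (x, b) and that of one of the given lifts lie over the same ring map, so a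
    morphism of X relates them and the values correspond under [psi]. *)
Lemma family_sep (M : gsheaf T X) (R : kring K) (y : gobj (Y R))
    (c : ess_cover y) (n p : kan_family Phi M y) :
  (forall i, n _ _ _ _ (@ec_over _ _ c i) = p _ _ _ _ (@ec_over _ _ c i)) -> n = p.
Proof.
move=> np; apply: family_ext => S f x b xb.
apply: (sheaf_sep K_infinite (f := @ec_map _ _ c) (h := f) (ec_cover c)) => Q t [i [s ts]].
have xbt : lies_over Phi y (t \o f) _ _ := over_push (f' := t \o f) (fun _ => erefl) xb.
have xbs : lies_over Phi y (t \o f) _ _ := over_push (f' := t \o f) ts (@ec_over _ _ c i).
have [a [xx' aE]] := over_full xbt xbs.
have push (q : kan_family Phi M y) : res M erefl (q S f x b xb) = fval q xbt.
  by rewrite (fval_push q xb xbt erefl).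
rewrite !push; apply: (bij_inj (psi_bij M xx')).
rewrite -!(fval_mor _ xx' xbt xbs aE).
by rewrite (fval_push n (@ec_over _ _ c i) xbs erefl ts erefl) np;
   rewrite -(fval_push p (@ec_over _ _ c i) xbs erefl ts erefl).
Qed.

Lemma over_unres (R R' S : kring K) (g : R ~> R') (y : gobj (Y R)) y'
    (f : R' ~> S) (f' : R ~> S) x b :
  pmap (p := objects Y) g y = y' -> (forall a, f' a = f (g a)) ->
  lies_over Phi y f' x b -> lies_over Phi y' f x b.
Proof.
move=> <- fE; have -> : f' = f \o g by exact: rmorph_ext.
by rewrite /lies_over (pgmap_comp Y f g).1.
Qed.

Section Gluing.
Variables (M : gsheaf T X) (R : kring K) (I : index_set) (S : I -> kring K).
Variables (f : forall i, R ~> S i) (P : I -> I -> kring K).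
Variables (l : forall j k, S j ~> P j k) (r : forall j k, S k ~> P j k).
Hypothesis fT : is_cover T f.
Hypothesis PT : forall j k, is_tensor (f j) (f k) (l j k) (r j k).
Variables (y : gobj (Y R)).
Variable n : forall i, kan_family Phi M (pmap (p := objects Y) (f i) y).
Hypothesis n_match : forall j k,
  fam_res (erefl (pmap (p := objects Y) (l j k) (pmap (p := objects Y) (f j) y))) (n j) =
  fam_res (tensor_point (X := objects Y) y (PT j k)) (n k).

(** The pair [s], [t] factors through the tensor product [P i j], where [n_match] identifies the two
    families. *)
Lemma match_indep i j (Q : kring K) (s : S i ~> Q) (t : S j ~> Q) x b xb xb' :
  (forall a, s (f i a) = t (f j a)) -> n i Q s x b xb = n j Q t x b xb'.
Proof.
move=> st; have [w [[wl wr] _]] := (PT i j).2 Q s t st.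
have xbw := over_unres (erefl (pmap (p := objects Y) (l i j) _)) (fun a => esym (wl a)) xb.
have := congr1 (fun q : kan_family Phi M _ => fval q xbw) (n_match i j).
rewrite /= (fval_irr (n i) xb (over_res _ xbw) wl erefl) => ->.
exact: fval_irr.
Qed.

(** This is the value of the glued family at one index. On the sieve pulled back to [Q] it is
    prescribed by the [n i], consistently by [match_indep], and the sheaf [M] glues these
    prescriptions. *)
Lemma glue_point (Q : kring K) (h : R ~> Q) x b (xb : lies_over Phi y h x b) :
  exists v : M Q x, forall (Q' : kring K) (t : Q ~> Q') i (s : S i ~> Q') xb',
    (forall a, t (h a) = s (f i a)) ->
    res M erefl v = n i Q' s (pmap (p := objects X) t x) (gfmor (pgmap Y t) b) xb'.
Proof.
have /= val (Q' : kring K) (t : Q ~> Q') (st : in_sieve f h t) :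
    exists v : M Q' (pmap (p := objects X) t x), forall i (s : S i ~> Q') xb',
      (forall a, t (h a) = s (f i a)) ->
      v = n i Q' s (pmap (p := objects X) t x) (gfmor (pgmap Y t) b) xb'.
  have [i [s ts]] := st.
  have xbs := over_unres (f' := t \o h) erefl ts (over_push (f' := t \o h) (fun _ => erefl) xb).
  exists (n i Q' s _ _ xbs) => j s' xb' ts'.
  by apply: match_indep => a; rewrite -ts.
have [|v [vE _]] := sheaf_sieve K_infinite (M := M) (h := h) (x := x)
    (m := fun Q' t st => sval (cid (val Q' t st))) fT.
  move=> Q' Q'' t u st st' e; have [i [s ts]] := st.
  have xbs := over_unres (f' := t \o h) erefl ts (over_push (f' := t \o h) (fun _ => erefl) xb).
  have xbus : lies_over Phi (pmap (p := objects Y) (f i) y) (u \o s)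
      (pmap (p := objects X) (u \o t) x) (gfmor (pgmap Y (u \o t)) b).
    apply: (over_unres (f' := u \o t \o h) erefl) => [a|] /=; first by rewrite ts.
    exact: over_push xb.
  rewrite (svalP (cid (val Q'' (u \o t) st')) i (u \o s) xbus) => [|a /=]; last by rewrite ts.
  rewrite (svalP (cid (val Q' t st)) i s xbs)//.
  by apply: fval_push => //; exact: (pgmap_comp Y u t).2.
exists v => Q' t i s xb' ts.
have st : in_sieve f h t by exists i, s.
by rewrite (vE Q' t st); apply: (svalP (cid (val Q' t st))).
Qed.

(** Choosing a value at each index raises no coherence problem, because separatedness of [M]
    determines it ([FU]). Compatibility with restriction and with [psi], the prescribed restrictions
    and uniqueness all reduce to comparisons on the sieve. *)
Lemma family_glue : exists! p : kan_family Phi M y, forall i, fam_res erefl p = n i.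
Proof.
pose F (Q : kring K) (h : R ~> Q) x b xb := cid (@glue_point Q h x b xb).
have FU (Q : kring K) (h : R ~> Q) x b (xb : lies_over Phi y h x b) (v : M Q x) :
    (forall (Q' : kring K) (t : Q ~> Q') i (s : S i ~> Q') xb',
      (forall a, t (h a) = s (f i a)) ->
      res M erefl v = n i Q' s (pmap (p := objects X) t x) (gfmor (pgmap Y t) b) xb') ->
    sval (F Q h x b xb) = v.
  move=> vE; apply: (sheaf_sep K_infinite (f := f) (h := h) fT) => Q' t [i [s ts]].
  have xbs := over_unres (f' := t \o h) erefl ts (over_push (f' := t \o h) (fun _ => erefl) xb).
  by rewrite (vE _ _ _ _ xbs)// (svalP (F Q h x b xb) _ _ _ _ xbs).
have F1 (Q Q' : kring K) (h : R ~> Q) (g : Q ~> Q') x x' b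
      (xb : lies_over Phi y h x b) (xb' : lies_over Phi y (g \o h) x' (gfmor (pgmap Y g) b))
      (e : pmap (p := objects X) g x = x') :
    sval (F _ _ _ _ xb') = res M e (sval (F _ _ _ _ xb)).
  apply: FU => Q'' t i s xb'' ts.
  have e' : pmap (p := objects X) (t \o g) x = pmap (p := objects X) t x'.
    by rewrite -e; exact: (pgmap_comp X t g).1.
  rewrite -(res_comp e erefl e').
  move: xb''; rewrite -[gfmor _ (gfmor _ _)](pgmap_comp Y t g).2.
  case: _ / e' => xb''; exact: (svalP (F _ _ _ _ xb)).
have F2 (Q : kring K) (h : R ~> Q) x x' a b (xx' : is_mor x x' a)
      (xb : lies_over Phi y h x (gmul b (gfmor (Phi Q) a))) (xb' : lies_over Phi y h x' b) :
    sval (F _ _ _ _ xb') = psi M xx' (sval (F _ _ _ _ xb)).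
  apply: FU => Q' t i s xbs' ts.
  have txx' := gf_is_mor (pgmap X t) xx'.
  rewrite -(psi_nat xx' txx' erefl erefl).
  have xbs := over_unres (f' := t \o h) erefl ts (over_push (f' := t \o h) (fun _ => erefl) xb).
  rewrite (svalP (F _ _ _ _ xb) _ _ _ _ xbs)//.
  apply/esym/fval_mor.
  by rewrite (gf_mul _ (gf_is_mor _ xx') xb') gmap_mor.
exists (@KanFamily _ _ _ _ _ M R y (fun Q h x b xb => sval (F Q h x b xb)) F1 F2).
split=> [i|p pn]; apply: family_ext => Q h x b xb /=.
  apply: FU => Q' t j s xb' ts.
  have xbt := over_push (f' := t \o h) (fun _ => erefl) xb.
  rewrite -(fval_push _ xb xbt erefl)//.
  exact: match_indep.
apply: FU => Q' t i s xb' ts.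
have xbt := over_push (f' := t \o h) (fun _ => erefl) xb.
rewrite -(fval_push p xb xbt erefl)// -(pn i) /=.
by apply: fval_irr => // a /=; rewrite ts.
Qed.

End Gluing.

(** * The module of families and its sheaf structure over Y *)

Section Carrier.
Variables (M : gsheaf T X).

(* Families over y form a type too large to carry a module; they are recovered
   from their values on a chosen cover of y by points of the essential image. *)
Definition kan (R : kring K) (y : gobj (Y R)) : Type :=
  {v : forall i : ec_idx (ess_cov y), M _ (ec_obj i) |
   exists n : kan_family Phi M y, forall i, v i = n _ _ _ _ (ec_over i)}.

Variables (R : kring K) (y : gobj (Y R)).

Definition to_family (u : kan y) : kan_family Phi M y := sval (cid (svalP u)).

Definition of_family (n : kan_family Phi M y) : kan y :=
  exist _ (fun i => n _ _ _ _ (ec_over i)) (ex_intro _ n (fun=> erefl)).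

Lemma of_familyK : cancel of_family to_family.
Proof.
move=> n; apply: (family_sep (c := ess_cov y)) => i.
by rewrite /to_family -(svalP (cid (svalP (of_family n)))).
Qed.

Lemma to_familyK : cancel to_family of_family.
Proof.
move=> u; apply: eq_sig_hprop => [v|]; first exact: Prop_irrelevance.
apply: functional_extensionality_dep => i /=.
by rewrite /to_family -(svalP (cid (svalP u))).
Qed.

Lemma kan_ext (u v : kan y) :
  (forall (S : kring K) (f : R ~> S) x b (xb : lies_over Phi y f x b),
     fval (to_family u) xb = fval (to_family v) xb) -> u = v.
Proof. by move=> uv; apply/(can_inj to_familyK)/family_ext. Qed.

HB.instance Definition _ := gen_eqMixin (kan y).
HB.instance Definition _ := gen_choiceMixin (kan y).

Definition kan_add (u v : kan y) := of_family (fam_add (to_family u) (to_family v)).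
Definition kan_opp (u : kan y) := of_family (fam_opp (to_family u)).
Definition kan_zero : kan y := of_family (fam_zero Phi M y).
Definition kan_scale (r : R) (u : kan y) := of_family (fam_scale r (to_family u)).

Let kan_addA : associative kan_add.
Proof. by move=> u v w; apply: kan_ext => S f x b xb; rewrite !of_familyK /= addrA. Qed.
Let kan_addC : commutative kan_add.
Proof. by move=> u v; apply: kan_ext => S f x b xb; rewrite !of_familyK /= addrC. Qed.
Let kan_add0 : left_id kan_zero kan_add.
Proof. by move=> u; apply: kan_ext => S f x b xb; rewrite !of_familyK /= add0r. Qed.
Let kan_addN : left_inverse kan_zero kan_opp kan_add.
Proof. by move=> u; apply: kan_ext => S f x b xb; rewrite !of_familyK /= addNr. Qed.
HB.instance Definition _ :=
  GRing.isZmodule.Build (kan y) kan_addA kan_addC kan_add0 kan_addN.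

Lemma to_familyD (u v : kan y) (S : kring K) (f : R ~> S) x b
    (xb : lies_over Phi y f x b) :
  fval (to_family (u + v)) xb = fval (to_family u) xb + fval (to_family v) xb.
Proof. by rewrite [u + v]/(kan_add u v) of_familyK. Qed.

Let kan_scaleA a b (u : kan y) : kan_scale a (kan_scale b u) = kan_scale (a * b) u.
Proof.
by apply: kan_ext => S f x c xc; rewrite !of_familyK /= rmorphM scalerA.
Qed.
Let kan_scale1 : left_id 1 kan_scale.
Proof.
by move=> u; apply: kan_ext => S f x c xc; rewrite !of_familyK /= rmorph1 scale1r.
Qed.
Let kan_scaleDr : right_distributive kan_scale +%R.
Proof.
move=> a u v; apply: kan_ext => S f x c xc.
by rewrite to_familyD !of_familyK /= scalerDr.
Qed.
Let kan_scaleDl (u : kan y) : {morph kan_scale^~ u : a b / a + b}.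
Proof.
move=> a b; apply: kan_ext => S f x c xc.
by rewrite to_familyD !of_familyK /= rmorphD scalerDl.
Qed.
HB.instance Definition _ := GRing.Zmodule_isLmodule.Build R (kan y)
  kan_scaleA kan_scale1 kan_scaleDr kan_scaleDl.

Lemma to_familyZ (r : R) (u : kan y) (S : kring K) (f : R ~> S) x b
    (xb : lies_over Phi y f x b) :
  fval (to_family (r *: u)) xb = f r *: fval (to_family u) xb.
Proof. by rewrite [r *: u]/(kan_scale r u) of_familyK. Qed.

End Carrier.

Section KanSheaf.
Variables (M : gsheaf T X).

Definition kan_res (R S : kring K) (f : R ~> S) (y : gobj (Y R)) (z : gobj (Y S))
    (yz : pmap (p := objects Y) f y = z) :
  {linear kan M y -> kan M z | f \; *:%R}.
Proof.
apply: (@mk_linear _ _ _ _ (fun u => of_family (fam_res yz (to_family u)))).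
- move=> u v; apply: kan_ext => Q h x b xb.
  by rewrite to_familyD !of_familyK.
- move=> r u; apply: kan_ext => Q h x b xb.
  by rewrite to_familyZ !of_familyK.
Defined.

Lemma to_family_res (R S : kring K) (f : R ~> S) (y : gobj (Y R)) (z : gobj (Y S))
    (yz : pmap (p := objects Y) f y = z) (u : kan M y) :
  to_family (kan_res yz u) = fam_res yz (to_family u).
Proof. exact: of_familyK. Qed.

Definition kan_sheaf : sheaf T (objects Y).
Proof.
apply: (@Sheaf K T (objects Y) (fun R y => kan M y : lmodType R) kan_res).
- move=> R y yy u; apply: kan_ext => Q h x b xb.
  by rewrite to_family_res /=; apply: fval_irr.
- move=> R S Q f g x y z xy yz xz u; apply: kan_ext => Q' h x' b xb.
  by rewrite !to_family_res /=; apply: fval_irr.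
- move=> R I S f fT P l r PT y m mP.
  have [|n [nE nU]] := family_glue fT (n := fun i => to_family (m i)) (PT := PT).
    by move=> j k; rewrite -!to_family_res; congr to_family; exact: mP.
  exists (of_family n); split=> [i|u uE].
    by apply: (can_inj (@to_familyK M _ _)); rewrite to_family_res of_familyK; exact: nE.
  apply: (can_inj (@to_familyK M _ _)); rewrite of_familyK; apply: nU => i.
  by rewrite -to_family_res; congr to_family; exact: uE.
Defined.

Definition kan_psi (R : kring K) (y z : gobj (Y R)) (c : gmor (Y R))
    (yz : is_mor y z c) : {linear kan M y -> kan M z}.
Proof.
apply: (@mk_linear _ _ _ _ (fun u => of_family (fam_tr (is_mor_inv yz) (to_family u)))).
- move=> u v; apply: kan_ext => Q h x b xb.
  by rewrite to_familyD !of_familyK.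
- move=> r u; apply: kan_ext => Q h x b xb.
  by rewrite to_familyZ !of_familyK.
Defined.

Lemma to_family_psi (R : kring K) (y z : gobj (Y R)) (c : gmor (Y R))
    (yz : is_mor y z c) (u : kan M y) :
  to_family (kan_psi yz u) = fam_tr (is_mor_inv yz) (to_family u).
Proof. exact: of_familyK. Qed.

Lemma kan_psiK (R : kring K) (y z : gobj (Y R)) (c : gmor (Y R))
    (yz : is_mor y z c) : cancel (kan_psi yz) (kan_psi (is_mor_inv yz)).
Proof.
move=> u; apply: kan_ext => Q h x b xb; rewrite !to_family_psi /=.
apply: fval_irr => //; have hyz := gf_is_mor (pgmap Y h) yz.
by rewrite (ginvK yz) (gf_inv _ yz) (gmulK hyz xb).
Qed.

Lemma kan_psiKV (R : kring K) (y z : gobj (Y R)) (c : gmor (Y R))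
    (yz : is_mor y z c) : cancel (kan_psi (is_mor_inv yz)) (kan_psi yz).
Proof.
move=> u; apply: kan_ext => Q h x b xb; rewrite !to_family_psi /=.
apply: fval_irr => //; have hyz := gf_is_mor (pgmap Y h) yz.
by rewrite (ginvK yz) (gf_inv _ yz) (gmulKV hyz xb).
Qed.

Definition kan_gsheaf : gsheaf T Y.
Proof.
apply: (@GSheaf K T Y kan_sheaf kan_psi).
- move=> R y z c yz; exact: Bijective (kan_psiK yz) (kan_psiKV yz).
- move=> R S f y z c yz y' z' yz' yy' zz' u; apply: kan_ext => Q h x b xb.
  rewrite to_family_psi !to_family_res to_family_psi /=; apply: fval_irr => //.
  by rewrite (pgmap_comp Y h f).2 -(gf_inv _ yz).
- move=> R x y z b a ab xy yz xz u; apply: kan_ext => Q h t c tc.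
  rewrite !to_family_psi /=; apply: fval_irr => //.
  have ht := gf_is_mor (pgmap Y h).
  rewrite -(gmulE ab) (ginvM xy yz) (gf_mul _ (is_mor_inv yz) (is_mor_inv xy)).
  by rewrite (gmulA tc (ht _ _ _ (is_mor_inv yz)) (ht _ _ _ (is_mor_inv xy))).
Defined.

End KanSheaf.

Definition fam_map (M N : gsheaf T X) (t : gsheaf_map M N) (R : kring K)
    (y : gobj (Y R)) (n : kan_family Phi M y) : kan_family Phi N y.
Proof.
apply: (@KanFamily _ _ _ _ _ N R y (fun S f x b xb => t S x (n S f x b xb))).
- by move=> S S' f g x x' b xb xb' e; rewrite (fval_res n xb xb' e) sapp_nat.
- by move=> S f x x' a b xx' xb xb'; rewrite (fval_psi n xx' xb xb') gsapp_psi.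
Defined.

Definition kan_map_at (M N : gsheaf T X) (t : gsheaf_map M N) (R : kring K)
    (y : gobj (Y R)) : {linear kan M y -> kan N y}.
Proof.
apply: (@mk_linear _ _ _ _ (fun u => of_family (fam_map t (to_family u)))).
- move=> u v; apply: kan_ext => Q h x b xb.
  by rewrite to_familyD !of_familyK /= linearD.
- move=> r u; apply: kan_ext => Q h x b xb.
  by rewrite to_familyZ !of_familyK /= linearZ.
Defined.

Lemma to_family_map (M N : gsheaf T X) (t : gsheaf_map M N) (R : kring K)
    (y : gobj (Y R)) (u : kan M y) :
  to_family (kan_map_at t y u) = fam_map t (to_family u).
Proof. exact: of_familyK. Qed.

Definition kan_map (M N : gsheaf T X) (t : gsheaf_map M N) :
  gsheaf_map (kan_gsheaf M) (kan_gsheaf N).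
Proof.
unshelve eapply GSheafMap.
- apply: (@SheafMap K T (objects Y) (kan_gsheaf M) (kan_gsheaf N) (kan_map_at t)).
  move=> R S f y z yz u; apply: kan_ext => Q h x b xb.
  by rewrite to_family_map !to_family_res to_family_map.
- move=> R y z c yz u; apply: kan_ext => Q h x b xb.
  by rewrite to_family_map !to_family_psi to_family_map.
Defined.

Definition kan_functor : functor (gsheaf_category T X) (gsheaf_category T Y).
Proof.
apply: (@Functor (gsheaf_category T X) (gsheaf_category T Y) kan_gsheaf kan_map).
- move=> M; apply: gsheaf_map_ext => R y u; apply: kan_ext => Q h x b xb.
  by rewrite to_family_map.
- move=> M N P s t; apply: gsheaf_map_ext => R y u; apply: kan_ext => Q h x b xb.
  by rewrite /= !of_familyK.
Defined.

(** * The counit *)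

Lemma counit_over (R : kring K) (x : gobj (X R)) :
  lies_over Phi (gfobj (Phi R) x) idfun x (gid (gfobj (Phi R) x)).
Proof. by rewrite /lies_over (pgmap_id Y R).1; exact: is_mor_id. Qed.

Lemma gid_push (R S : kring K) (f : R ~> S) (x : gobj (X R)) (z : gobj (X S)) :
  pmap (p := objects X) f x = z ->
  gid (gfobj (Phi S) z) = gfmor (pgmap Y f) (gid (gfobj (Phi R) x)).
Proof. by move=> <-; rewrite gf_id -gmap_obj. Qed.

Section Counit.
Variable M : gsheaf T X.

Definition counit_at (R : kring K) (x : gobj (X R)) :
  {linear kan M (gfobj (Phi R) x) -> M R x}.
Proof.
apply: (@mk_linear _ _ _ _ (fun u => fval (to_family u) (counit_over x))).
- by move=> u v; rewrite to_familyD.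
- by move=> r u; rewrite to_familyZ.
Defined.

Definition counit : gsheaf_map (gsheaf_pullback Phi (kan_gsheaf M)) M.
Proof.
unshelve eapply GSheafMap.
- apply: (@SheafMap K T (objects X) (gsheaf_pullback Phi (kan_gsheaf M)) M counit_at).
  move=> R S f x z xz u; rewrite /= of_familyK /=.
  by apply: fval_push => //; exact: gid_push xz.
- move=> R x z a xz u; rewrite /= of_familyK /=.
  have Fxz := gf_is_mor (Phi R) xz.
  apply: fval_mor; rewrite (pgmap_id Y R).2.
  by rewrite (gmulm1 (is_mor_inv Fxz)) (gmulVm Fxz).
Defined.

(** Fullness writes [b] as an identity composed with some Phi a. So [psi] carries the value at (f,
    x', b) to the value at f, the image of x and the identity, which is the restriction of the value
    at (id, x, id). *)
Lemma counit_inj (R : kring K) (x : gobj (X R)) : injective (counit R x).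
Proof.
move=> u v /= uv; apply: kan_ext => S f x' b xb.
have xb' : is_mor (gfobj (Phi S) x') (gfobj (Phi S) (gfobj (pgmap X f) x)) b.
  by rewrite gmap_obj.
have [a [xa aE]] := (Phi_equiv.1 S).1 _ _ _ xb'.
have ox : lies_over Phi (gfobj (Phi R) x) f (gfobj (pgmap X f) x)
    (gid (gfobj (Phi S) (gfobj (pgmap X f) x))).
  by rewrite /lies_over -gmap_obj; exact: is_mor_id.
have bE : b = gmul (gid (gfobj (Phi S) (gfobj (pgmap X f) x))) (gfmor (Phi S) a).
  by rewrite aE (gmul1m xb').
apply: (bij_inj (psi_bij M xa)).
rewrite -(fval_mor (to_family u) xa xb ox bE) -(fval_mor (to_family v) xa xb ox bE).
rewrite (fval_push (to_family u) (counit_over x) ox erefl)//; last exact: gid_push.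
rewrite (fval_push (to_family v) (counit_over x) ox erefl)//; last exact: gid_push.
by rewrite uv.
Qed.

(** A family with value [m] at (id, x, id) must take at (f, x', b) the preimage under [psi] at [a]
    of the restriction of [m], where Phi a = b. Fullness supplies [a], and faithfulness makes it
    unique. *)
Lemma counit_surj (R : kring K) (x : gobj (X R)) (m : M R x) :
  exists u, counit R x u = m.
Proof.
(* Quantifying over [z] and [a] lets the value be used, and through [FU] recognized, with whichever
   lift is at hand. *)
have val (S : kring K) (f : R ~> S) x' b (xb : lies_over Phi (gfobj (Phi R) x) f x' b) :
    exists v : M S x', forall z (e : pmap (p := objects X) f x = z) a
      (xa : is_mor x' z a), gfmor (Phi S) a = b -> psi M xa v = res M e m.
  have xb' : is_mor (gfobj (Phi S) x') (gfobj (Phi S) (gfobj (pgmap X f) x)) b.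
    by rewrite gmap_obj.
  have [a [xa aE]] := (Phi_equiv.1 S).1 _ _ _ xb'.
  have [g _ gK] := psi_bij M xa; exists (g (res M erefl m)) => z e a' xa' a'E.
  move: e => /= e; case: _ / e xa' => xa'.
  rewrite -[RHS]gK; apply: psi_irr.
  by apply: ((Phi_equiv.1 S).2 _ _ _ _ xa' xa); rewrite aE.
pose F S f x' b xb := cid (val S f x' b xb).
have FU S f x' b xb z (e : pmap (p := objects X) f x = z) a (xa : is_mor x' z a) v :
    gfmor (Phi S) a = b -> psi M xa v = res M e m -> sval (F S f x' b xb) = v.
  move=> aE ve; apply: (bij_inj (psi_bij M xa)).
  by rewrite (svalP (F S f x' b xb) z e a xa aE).
have lift (S : kring K) (f : R ~> S) x' b (xb : lies_over Phi (gfobj (Phi R) x) f x' b) :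
    exists a, is_mor x' (gfobj (pgmap X f) x) a /\ gfmor (Phi S) a = b.
  by apply: (Phi_equiv.1 S).1; rewrite gmap_obj.
have F1 (S S' : kring K) (f : R ~> S) (g : S ~> S') x1 x2 b
      (xb : lies_over Phi (gfobj (Phi R) x) f x1 b)
      (xb' : lies_over Phi (gfobj (Phi R) x) (g \o f) x2 (gfmor (pgmap Y g) b))
      (e : pmap (p := objects X) g x1 = x2) :
    sval (F _ _ _ _ xb') = res M e (sval (F _ _ _ _ xb)).
  have [a [xa aE]] := lift _ _ _ _ xb.
  have e' : pmap (p := objects X) (g \o f) x = gfobj (pgmap X g) (gfobj (pgmap X f) x).
    exact: (pgmap_comp X g f).1.
  have gxa : is_mor x2 (gfobj (pgmap X g) (gfobj (pgmap X f) x)) (gfmor (pgmap X g) a).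
    by rewrite -e; exact: gf_is_mor.
  apply: (FU _ _ _ _ _ _ e' _ gxa); first by rewrite gmap_mor aE.
  rewrite (psi_nat xa gxa e erefl) (svalP (F _ _ _ _ xb) _ erefl _ xa aE).
  by rewrite -(res_comp erefl erefl e').
have F2 (S : kring K) (f : R ~> S) x1 x2 a b (xx' : is_mor x1 x2 a)
      (xb : lies_over Phi (gfobj (Phi R) x) f x1 (gmul b (gfmor (Phi S) a)))
      (xb' : lies_over Phi (gfobj (Phi R) x) f x2 b) :
    sval (F _ _ _ _ xb') = psi M xx' (sval (F _ _ _ _ xb)).
  have [c [xc cE]] := lift _ _ _ _ xb'.
  apply: (FU _ _ _ _ _ _ erefl _ xc) => //.
  rewrite -(psi_mul xx' xc (is_mor_mul xx' xc)).
  by apply: (svalP (F _ _ _ _ xb)); rewrite (gf_mul _ xx' xc) cE.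
exists (of_family (@KanFamily _ _ _ _ _ M R _ (fun S f x' b xb => sval (F S f x' b xb)) F1 F2)).
rewrite /= of_familyK /=.
have e : pmap (p := objects X) idfun x = x := (pgmap_id X R).1 x.
apply: (FU _ _ _ _ _ _ e _ (is_mor_id x)); first exact: gf_id.
by rewrite psi_id res_id.
Qed.

End Counit.

(** * The unit *)

Section Unit.
Variable N : gsheaf T Y.

Lemma psi_res_eq (R S : kring K) (f : R ~> S) (y : gobj (Y R)) (x z : gobj (Y S)) a
    (e : pmap (p := objects Y) f y = z) (m : N R y)
    (yx : is_mor (pmap (p := objects Y) f y) x a) (zx : is_mor z x a) :
  psi N yx (res N erefl m) = psi N zx (res N e m).
Proof. by case: _ / e zx => zx; rewrite (Prop_irrelevance yx zx). Qed.

Definition unit_family (R : kring K) (y : gobj (Y R)) (m : N R y) :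
  kan_family Phi (gsheaf_pullback Phi N) y.
Proof.
apply: (@KanFamily _ _ _ _ _ (gsheaf_pullback Phi N) R y (fun S f x b xb =>
          psi N (is_mor_inv xb) (res N (erefl (pmap (p := objects Y) f y)) m))).
- move=> S S' f g x x' b xb xb' e.
  have xb'' : is_mor (pmap (p := objects Y) (g \o f) y) (gfobj (Phi S') x')
      (gfmor (pgmap Y g) (ginv b)) by rewrite (gf_inv _ xb); exact: is_mor_inv.
  rewrite (psi_irr _ xb'') ?(gf_inv _ xb)//.
  have e' : pmap (p := objects Y) g (pmap (p := objects Y) f y) =
            pmap (p := objects Y) (g \o f) y by rewrite pmap_comp.
  rewrite (res_comp erefl e' erefl).
  by rewrite (psi_nat (is_mor_inv xb) xb'' e' (papp_eq (objects_map Phi) e)).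
- move=> S f x x' a b xx' xb xb' /=.
  pose Fxx' := gf_is_mor (Phi S) xx'.
  rewrite -(psi_mul _ Fxx' (is_mor_mul (is_mor_inv xb) Fxx')).
  apply: psi_irr; rewrite (ginvM Fxx' xb').
  by rewrite (gmulKV Fxx' (is_mor_inv xb')).
Defined.

Definition unit_at (R : kring K) (y : gobj (Y R)) :
  {linear N R y -> kan (gsheaf_pullback Phi N) y}.
Proof.
apply: (@mk_linear _ _ _ _ (fun m => of_family (unit_family m))).
- move=> u v; apply: kan_ext => S f x b xb.
  by rewrite to_familyD !of_familyK /= !linearD.
- move=> r u; apply: kan_ext => S f x b xb.
  by rewrite to_familyZ !of_familyK /= !linearZ.
Defined.

Definition kan_unit : gsheaf_map N (kan_gsheaf (gsheaf_pullback Phi N)).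
Proof.
unshelve eapply GSheafMap.
- apply: (@SheafMap K T (objects Y) N (kan_gsheaf (gsheaf_pullback Phi N)) unit_at).
  move=> R S f y z yz m; apply: kan_ext => Q h x b xb; rewrite /= !of_familyK /=.
  have e : pmap (p := objects Y) (h \o f) y = pmap (p := objects Y) h z.
    by rewrite -yz pmap_comp.
  rewrite -(res_comp yz erefl e).
  exact/esym/psi_res_eq.
- move=> R y z c yz m; apply: kan_ext => Q h x b xb; rewrite /= !of_familyK /=.
  have hyz := gf_is_mor (pgmap Y h) yz.
  rewrite -(psi_nat yz hyz erefl erefl).
  rewrite -(psi_mul hyz (is_mor_inv xb) (is_mor_mul hyz (is_mor_inv xb))).
  apply: psi_irr; have hzy := is_mor_inv hyz.
  by rewrite (gf_inv _ yz) (ginvM xb hzy) (ginvK hyz).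
Defined.

(** The values at the chosen lifts are, up to the bijections [psi], the restrictions of [m] to a
    cover, and [N] is separated. *)
Lemma kan_unit_inj (R : kring K) (y : gobj (Y R)) : injective (kan_unit R y).
Proof.
move=> m m' /(congr1 (@to_family _ _ _)) /=; rewrite !of_familyK => mm'.
have {}mm' i : res N (erefl (pmap (p := objects Y) (@ec_map _ _ (ess_cov y) i) y)) m =
               res N erefl m'.
  have := congr1 (fun n : kan_family _ _ _ => fval n (@ec_over _ _ (ess_cov y) i)) mm'.
  exact: (bij_inj (psi_bij N (is_mor_inv (@ec_over _ _ (ess_cov y) i)))).
apply: (sheaf_sep K_infinite (h := idfun) (ec_cover (ess_cov y))) => Q t [i [s ts]].
have tE : t = s \o @ec_map _ _ (ess_cov y) i by exact: rmorph_ext.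
rewrite tE; have e : pmap (p := objects Y) s (pmap (p := objects Y) (@ec_map _ _ (ess_cov y) i) y)
  = pmap (p := objects Y) (s \o @ec_map _ _ (ess_cov y) i) y by rewrite pmap_comp.
by rewrite !(res_comp erefl e erefl) mm'.
Qed.

(** The preimage [m] is glued in [N] from the elements psi_b n(t, x, b), for [t] in the sieve of the
    chosen cover. There a lift (x, b) exists, and by [over_full] the element does not depend on
    it. *)
Lemma kan_unit_surj (R : kring K) (y : gobj (Y R))
    (u : kan (gsheaf_pullback Phi N) y) :
  exists m, kan_unit R y m = u.
Proof.
pose n := to_family u; pose c := ess_cov y.
have push (Q Q' : kring K) (t : R ~> Q) (w : Q ~> Q') x b
    (xb : lies_over Phi y t x b) z (e : pmap (p := objects Y) w (pmap (p := objects Y) t y) = z)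
    (xbw : lies_over Phi y (w \o t) (gfobj (pgmap X w) x) (gfmor (pgmap Y w) b))
    (xz : is_mor (gfobj (Phi Q') (gfobj (pgmap X w) x)) z (gfmor (pgmap Y w) b)) :
    res N e (psi N xb (fval n xb)) = psi N xz (fval n xbw).
  rewrite (fval_push n xb xbw erefl)//.
  by rewrite -(psi_nat xb xz (papp_eq (objects_map Phi) erefl) e).
have /= val (Q : kring K) (t : R ~> Q) (st : in_sieve (@ec_map _ _ c) idfun t) :
    exists v : N Q (pmap (p := objects Y) t y),
      forall x b (xb : lies_over Phi y t x b), v = psi N xb (fval n xb).
  have [i [s ts]] := st.
  have xs := over_push (f' := t) ts (@ec_over _ _ c i).
  exists (psi N xs (fval n xs)) => x b xb.
  have [a [xa aE]] := over_full xb xs.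
  rewrite (fval_mor n xa xb xs aE) /=.
  pose Fxa := gf_is_mor (Phi Q) xa.
  rewrite -(psi_mul Fxa xs (is_mor_mul Fxa xs)).
  by apply: psi_irr; rewrite -aE.
have [|m [mE _]] := sheaf_sieve K_infinite (M := N) (h := idfun) (x := y)
    (m := fun Q t st => sval (cid (val Q t st))) (ec_cover c).
  move=> Q Q' t w st st' e; have [i [s ts]] := st.
  have xs := over_push (f' := t) ts (@ec_over _ _ c i).
  have xw := over_push (f' := w \o t) (fun=> erefl) xs.
  rewrite (svalP (cid (val _ _ st')) _ _ xw) (svalP (cid (val _ _ st)) _ _ xs).
  exact/esym/push.
have {}mE (Q : kring K) (t : R ~> Q) z (e : pmap (p := objects Y) t y = z) x b
    (xb : lies_over Phi y t x b) (xz : is_mor (gfobj (Phi Q) x) z b) :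
    in_sieve (@ec_map _ _ c) idfun t -> res N e m = psi N xz (fval n xb).
  move=> st; move: xz; case: _ / e => xz; rewrite (mE _ _ st).
  by rewrite (svalP (cid (val _ _ st)) _ _ xb) (Prop_irrelevance xz xb).
exists m; apply: kan_ext => S f x b xb; rewrite /= of_familyK /=.
apply: (bij_inj (psi_bij N xb)).
have -> : psi N xb (psi N (is_mor_inv xb) (res N erefl m)) = res N erefl m.
  rewrite -(psi_mul (is_mor_inv xb) xb (is_mor_mul (is_mor_inv xb) xb)).
  rewrite -[RHS](psi_id (is_mor_id _)); apply: psi_irr; exact: gmulmV xb.
(* An arbitrary [f] need not lie in the sieve, where alone [m] is known; but [t \o f] does for [t]
   in the sieve pulled back along [f]. *)
apply: (sheaf_sep K_infinite (h := f) (ec_cover c)) => Q t st.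
have xt := over_push (f' := t \o f) (fun=> erefl) xb.
have xz := gf_is_mor (pgmap Y t) xb; rewrite -gmap_obj in xz.
rewrite (push _ _ _ _ _ _ _ _ erefl xt xz).
have e : pmap (p := objects Y) (t \o f) y = pmap (p := objects Y) t (pmap (p := objects Y) f y).
  by rewrite pmap_comp.
by rewrite -(res_comp erefl erefl e); exact: mE.
Qed.

End Unit.
End Extension.

(** * Pointwise bijections and the equivalence of categories *)

Lemma inj_surj_bij (A B : Type) (f : A -> B) :
  injective f -> (forall b, exists a, f a = b) -> bijective f.
Proof.
move=> fI /choice[g gK]; exists g => // a; exact/fI/gK.
Qed.

(** Linearity, naturality and compatibility with [psi] of the pointwise inverse are equations that
    can be checked after applying the injective [t]. *)
Lemma gsheaf_map_inverse (K : Type) (T : topology K) (X : presheaf_of_groupoids K)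
    (M N : gsheaf T X) (t : gsheaf_map M N) :
  (forall (R : kring K) (x : gobj (X R)), bijective (t R x)) ->
  exists t' : gsheaf_map N M,
    gsheaf_comp t' t = gsheaf_id M /\ gsheaf_comp t t' = gsheaf_id N.
Proof.
move=> tB; have ex (R : kring K) (x : gobj (X R)) :
    exists g, cancel (t R x) g /\ cancel g (t R x).
  by have [g] := tB R x; exists g.
pose g (R : kring K) (x : gobj (X R)) := sval (cid (ex R x)).
have tg (R : kring K) (x : gobj (X R)) : cancel (g R x) (t R x).
  exact: (svalP (cid (ex R x))).2.
have gt (R : kring K) (x : gobj (X R)) : cancel (t R x) (g R x).
  exact: (svalP (cid (ex R x))).1.
have gD (R : kring K) (x : gobj (X R)) : {morph g R x : u v / u + v}.
  by move=> u v; apply: (can_inj (gt R x)); rewrite linearD !tg.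
have gZ (R : kring K) (x : gobj (X R)) : scalable_for *:%R (g R x).
  by move=> r u; apply: (can_inj (gt R x)); rewrite linearZ !tg.
pose gl (R : kring K) (x : gobj (X R)) := mk_linear (gD R x) (gZ R x).
have gl_nat (R S : kring K) (f : R ~> S) (x : objects X R) (y : objects X S)
    (xy : pmap f x = y) (m : N R x) : gl S y (res N xy m) = res M xy (gl R x m).
  by apply: (can_inj (gt S y)); rewrite (sapp_nat t) /= !tg.
have gl_psi (R : kring K) (x y : gobj (X R)) a (xy : is_mor x y a) (m : N R x) :
    gl R y (psi N xy m) = psi M xy (gl R x m).
  by apply: (can_inj (gt R y)); rewrite (gsapp_psi t) /= !tg.
exists (@GSheafMap K T X N M (@SheafMap K T (objects X) N M gl gl_nat) gl_psi).
by split; apply: gsheaf_map_ext => R x m /=; [exact: gt|exact: tg].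
Qed.

Lemma naturally_isomorphic_of_iso (C D : category) (F G : functor C D)
    (eta : forall A, chom (F A) (G A)) :
  (forall A B (f : chom A B), ccomp (eta B) (fmap F f) = ccomp (fmap G f) (eta A)) ->
  (forall A, exists theta : chom (G A) (F A),
     ccomp theta (eta A) = Defs.cid (F A) /\ ccomp (eta A) theta = Defs.cid (G A)) ->
  naturally_isomorphic F G.
Proof.
move=> eta_nat etaV; exists eta, (fun A => sval (cid (etaV A))).
by split=> // A; [exact: (svalP (cid (etaV A))).1|exact: (svalP (cid (etaV A))).2].
Qed.

Lemma naturally_isomorphic_sym (C D : category) (F G : functor C D) :
  naturally_isomorphic F G -> naturally_isomorphic G F.
Proof.
move=> [eta [theta [eta_nat te et]]]; exists theta, eta; split=> // A B f.
rewrite -[fmap G f]ccompm1 -et [ccomp (fmap G f) _]ccompA -eta_nat !ccompA te.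
by rewrite ccomp1m.
Qed.

Theorem theorem2 (K : Type) (K_infinite : infinite_set [set: K])
  (T : topology K) (X Y : presheaf_of_groupoids K) (Phi : groupoids_map X Y)
  (Phi_equiv : internal_equivalence T Phi) :
  is_equivalence (pullback_functor T Phi).
Proof.
exists (kan_functor K_infinite Phi_equiv); split.
(* The unit leaves the identity functor, whereas the definition of an equivalence asks for an
   isomorphism into it. *)
- apply: naturally_isomorphic_sym.
  apply: (@naturally_isomorphic_of_iso (gsheaf_category T Y) (gsheaf_category T Y)
            (id_functor _)
            (comp_functor (kan_functor K_infinite Phi_equiv) (pullback_functor T Phi))
           (kan_unit K_infinite Phi_equiv)) => [M N t|M].
    apply: gsheaf_map_ext => R y m; apply: kan_ext => S f x b xb.
    by rewrite /= !(of_familyK K_infinite) /= -(sapp_nat t) -(gsapp_psi t).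
  have unitB (R : kring K) (y : gobj (Y R)) :
      bijective (kan_unit K_infinite Phi_equiv M R y).
    by apply: inj_surj_bij; [exact: kan_unit_inj|exact: kan_unit_surj].
  exact: gsheaf_map_inverse unitB.
- apply: (@naturally_isomorphic_of_iso (gsheaf_category T X) (gsheaf_category T X)
            (comp_functor (pullback_functor T Phi) (kan_functor K_infinite Phi_equiv))
            (id_functor _)
           (counit K_infinite Phi_equiv)) => [M N t|M].
    by apply: gsheaf_map_ext => R x u; rewrite /= (of_familyK K_infinite).
  have counitB (R : kring K) (x : gobj (X R)) :
      bijective (counit K_infinite Phi_equiv M R x).
    by apply: inj_surj_bij; [exact: counit_inj|exact: counit_surj].
  exact: gsheaf_map_inverse counitB.
Qed.
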